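(* Fix $k\in\mathbb{R}^n_+$, consider the corresponding optimal control $\widehat C\in\mathcal{A}_+(k)$ for the problem defining $V(k)$, and let $K^{k,\widehat C}$ be the solution of the state equation with initial condition $k$ and control $\widehat C$. Then, for all $t\ge0$ such that $K^{k,\widehat C}(t)\in\mathbb{R}^n_{++}$, $\widehat C(t)$ is continuous, strictly positive, and satisfies $$\widehat C(t)=\widehat c\big(\mathrm{D}V(K^{k,\widehat C}(t))\big),$$ where $\widehat c:\mathbb{R}^n_{++}\to\mathbb{R}^n_{++}$ is given by $$\widehat c_i(q)=\left(\frac{p_i}{[N^Tq]_i}\right)^{1/\gamma},\quad i=1,\dots,n,\quad q\in\mathbb{R}^n_{++}.$$
   Context: Notation: $\mathbb{R}^n_+$ and $\mathbb{R}^n_{++}$ are the sets of vectors in $\mathbb{R}^n$ with all components $\ge 0$, resp. $>0$; $\{e_1,\dots,e_n\}$ is the canonical basis; $[x]_i$ is the $i$-th component of $x$. Data: $n\ge 2$; $A=\mathrm{diag}(A_1,\dots,A_n)$ with $A_i>0$; $L$ is a real $n\times n$ matrix with $e^{tL}(\mathbb{R}^n_+)\subseteq\mathbb{R}^n_+$ for all $t\ge0$ (i.e. off-diagonal entries $\ge 0$); $N$ is a real $n\times n$ matrix with $N(\mathbb{R}^n_+)\subseteq\mathbb{R}^n_+$ and $Ne_i\ne 0$ for all $i$; $\rho>0$, $\gamma>0$, $p_1,\dots,p_n>0$. There is an eigenvector $b^\star\in\mathbb{R}^n_{++}$ of $(L+A)^T$ with eigenvalue $\lambda_\star>0$, where $\lambda_\star$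 is the dominant (Frobenius) eigenvalue of $(L+A)^T$, and $\rho>\lambda_\star(1-\gamma)$. State equation: for $k\in\mathbb{R}^n_+$ and $C\in L^1_{\mathrm{loc}}([0,+\infty);\mathbb{R}^n_+)$, $K^{k,C}$ is the solution of $K'(t)=(L+A)K(t)-NC(t)$, $t\ge0$, $K(0)=k$, and $\mathcal{A}_+(k)=\{C\in L^1_{\mathrm{loc}}([0,+\infty);\mathbb{R}^n_+): K^{k,C}(t)\in\mathbb{R}^n_+\ \forall t\ge0\}$. Utility: $u_\gamma:\mathbb{R}_+\to\mathbb{R}\cup\{-\infty\}$, $u_\gamma(x)=\frac{x^{1-\gamma}}{1-\gamma}$ if $\gamma\ne1$, $u_1(x)=\log x$, for $x\ge0$; $U_\gamma(x)=\sum_{i=1}^np_iu_\gamma(x_i)$. Value function: $V(k)=\sup_{C\in\mathcal{A}_+(k)}\int_0^{+\infty}e^{-\rho t}U_\gamma(C(t))\,dt$, $k\in\mathbb{R}^n_+$; a control in $\mathcal{A}_+(k)$ attaining the supremum is called optimal. $\mathrm{D}V$ is the gradient of $V$, which is continuously differentiable on $\mathbb{R}^n_{++}$ by a preceding result.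
   Formalization: The optimal control is assumed unique up to null sets (if V(k) = -∞ it need not be, and the claim can fail); the conclusion is for a suitable representative of its a.e. class; ĉ is applied by its formula even when DV(K(t)) is not strictly positive (possible for singular N). *)

(* Defs.v *)
From HB Require Import structures.
From mathcomp Require Import all_boot all_order all_algebra.
From mathcomp Require Import all_classical all_reals all_analysis.
From mathcomp Require Import complex.

Set Implicit Arguments.
Unset Strict Implicit.
Unset Printing Implicit Defensive.

Import Order.TTheory GRing.Theory Num.Theory.
Import numFieldNormedType.Exports.

Local Open Scope classical_set_scope.
Local Open Scope ring_scope.

Section Orthants.
Context {R : realType} {n : nat}.

Definition orthant : set 'cV[R]_n := [set x | forall i, 0 <= x i 0].

Definition pos_orthant : set 'cV[R]_n := [set x | forall i, 0 < x i 0].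

Definition preserves_orthant (M : 'M[R]_n) : Prop :=
  forall x, orthant x -> orthant (M *m x).

End Orthants.

Definition expmx {R : realType} {n : nat} (M : 'M[R]_n) : 'M[R]_n :=
  lim (series (fun m : nat => (m`!%:R)^-1 *: M ^+ m) @ \oo).

(* lam bounds the real parts of all the complex eigenvalues of M: for a matrix
   with nonnegative off-diagonal entries, an eigenvalue with this property is
   the dominant (Frobenius) one. *)
Definition dominates_spectrum {R : realType} {n : nat}
    (M : 'M[R]_n) (lam : R) : Prop :=
  forall mu : complex R,
    eigenvalue (map_mx (real_complex R) M) mu -> complex.Re mu <= lam.

Definition gradient {R : realType} {n : nat} (f : 'cV[R]_n -> R)
    (x : 'cV[R]_n) : 'cV[R]_n :=
  \col_i ('D_(delta_mx i 0) f x).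

Definition continuously_differentiable {R : realType} {n : nat}
    (D : set 'cV[R]_n) (f : 'cV[R]_n -> R) : Prop :=
  forall x, D x -> differentiable f x /\ {for x, continuous (gradient f)}.

Section ControlProblem.
Context {R : realType} {n : nat}.

Local Notation leb := (@lebesgue_measure R).

(* Controls are functions on R of which only the values on [0, +oo[ matter;
   the classes of L^1_loc are recovered by the relation ae_equal below. *)
Definition L1loc_orthant (C : R -> 'cV[R]_n) : Prop :=
  (forall t, 0 <= t -> orthant (C t)) /\
  (forall (i : 'I_n) (T : R), 0 <= T ->
     leb.-integrable `[0, T] (fun t => (C t i 0)%:E)).

Definition ae_equal (C C' : R -> 'cV[R]_n) : Prop :=
  {ae leb, forall t, 0 <= t -> C t = C' t}.

(* Caratheodory solutions of K' = (L + A) K - N C on [0, +oo[, K(0) = k, by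
   means of the integral equation. *)
Definition state_solution (L A N : 'M[R]_n) (k : 'cV[R]_n)
    (C K : R -> 'cV[R]_n) : Prop :=
  {within `[0, +oo[, continuous K} /\
  forall (t : R) (i : 'I_n), 0 <= t ->
    K t i 0 = k i 0 +
      (\int[leb]_(s in `[0%R, t]) (((L + A) *m K s - N *m C s) i 0))%R.

Definition admissible (L A N : 'M[R]_n) (k : 'cV[R]_n) (C : R -> 'cV[R]_n) :
    Prop :=
  L1loc_orthant C /\
  exists K, state_solution L A N k C K /\ forall t, 0 <= t -> orthant (K t).

(* The case x = 0 < gamma - 1 is separated because 0 `^ r = 0 for r < 0;
   lne 0 = -oo. *)
Definition utility (gamma x : R) : \bar R :=
  if gamma == 1 then lne x%:E
  else if (1 < gamma) && (x == 0) then -oo%E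
  else ((x `^ (1 - gamma)) / (1 - gamma))%:E.

Definition total_utility (gamma : R) (p : 'I_n -> R) (x : 'cV[R]_n) : \bar R :=
  (\sum_(i < n) (p i)%:E * utility gamma (x i 0%R))%E.

Definition payoff (rho gamma : R) (p : 'I_n -> R) (C : R -> 'cV[R]_n) :
    \bar R :=
  (\int[leb]_(t in `[0%R, +oo[)
     ((expR (- rho * t)%R)%:E * total_utility gamma p (C t)))%E.

Definition value (L A N : 'M[R]_n) (rho gamma : R) (p : 'I_n -> R)
    (k : 'cV[R]_n) : \bar R :=
  ereal_sup [set payoff rho gamma p C | C in [set C | admissible L A N k C]].

Definition optimal (L A N : 'M[R]_n) (rho gamma : R) (p : 'I_n -> R)
    (k : 'cV[R]_n) (C : R -> 'cV[R]_n) : Prop :=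
  admissible L A N k C /\
  payoff rho gamma p C = value L A N rho gamma p k.

(* Uniqueness is not automatic: it fails for some k on the boundary of the
   orthant with value -oo, where every admissible control is optimal. *)
Definition is_the_optimal (L A N : 'M[R]_n) (rho gamma : R) (p : 'I_n -> R)
    (k : 'cV[R]_n) (C : R -> 'cV[R]_n) : Prop :=
  optimal L A N rho gamma p k C /\
  forall C', optimal L A N rho gamma p k C' -> ae_equal C' C.

(* The real-valued value function; it is the value function wherever the
   latter is finite. *)
Definition fine_value (L A N : 'M[R]_n) (rho gamma : R) (p : 'I_n -> R)
    (k : 'cV[R]_n) : R :=
  fine (value L A N rho gamma p k).

Definition c_hat (N : 'M[R]_n) (gamma : R) (p : 'I_n -> R) (q : 'cV[R]_n) :
    'cV[R]_n :=
  \col_i ((p i / (N^T *m q) i 0) `^ (gamma^-1)).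

End ControlProblem.

(* Main.v *)
(* Along the optimal trajectory, dynamic programming makes
   s |-> \int_0^s e^(-rho u) U(C u) du + e^(-rho s) V(K s)
   constant as long as K s is interior, so at almost every such time t (Lebesgue
   differentiation and the chain rule for V) the Hamilton-Jacobi-Bellman equation
   holds with the consumption C t.  Running an arbitrary constant consumption
   c > 0 for a short time and then continuing almost optimally gives the
   inequality <= 0 for the same Hamiltonian.  Hence C t maximizes
   U(c) - <N^T DV(K t), c>, and strict concavity of the utility identifies the
   maximizer as c_hat (DV (K t)).
   That N^T DV(K t) is positive at every interior time, not only at almost every
   one, comes from perturbing the optimal control: from K t + s N e_i one can
   afford a little more of the i-th consumption, and concavity turns the
   resulting finite gain in utility into a lower bound for the derivative of V
   in the direction N e_i. *)
Require Import Defs.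
From HB Require Import structures.
From mathcomp Require Import all_boot all_order all_algebra.
From mathcomp Require Import all_classical all_reals all_analysis.
From mathcomp Require Import measurable_realfun.
From mathcomp Require Import ring lra.
Import Order.TTheory GRing.Theory Num.Theory.
Import numFieldNormedType.Exports.
Local Open Scope classical_set_scope.
Local Open Scope ring_scope.
Set Implicit Arguments.
Unset Strict Implicit.
Unset Printing Implicit Defensive.

(** * Extended-real integrals *)

(** Utilities can take the value [-oo], and so can [value] at boundary points of the orthant; an
    optimal control starting there has no finite payoff a priori, and payoffs may be subtracted only
    once they are known to be finite. This is where uniqueness of the optimal control enters: if the
    trajectory is interior at time [a] while the gain accumulated before [a] is [-oo], then every
    admissible continuation after [a] is optimal as well, and two distinct ones exist. For the same
    reason the basic integral identities are proved for measurable functions, without integrability.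

    The perturbation along N e_i is affordable because the off-diagonal entries of L + A are
    nonnegative. For c large, P = L + A + c I is a nonnegative matrix, and from N e_i one can
    consume e^(-ct) e_i up to time 1, since the integral of e^(sP) N e_i over [0, t] stays below
    e^(tP) N e_i when t <= 1.

    The Hamiltonian argument determines the control only almost everywhere; redefining it as the
    feedback at all interior times gives the representative that satisfies the formula
    everywhere. *)

Section ExtendedIntegral.
Local Open Scope ereal_scope.
Context d (T : measurableType d) (R : realType) (mu : {measure set T -> \bar R}).

(* [-oo] is absorbing for [+], so the conventions for [+oo - oo] agree on both sides. *)
Lemma measurable_integral_setU (A B : set T) (f : T -> \bar R) :
  measurable A -> measurable B -> measurable_fun (A `|` B) f ->
  [disjoint A & B] ->
  \int[mu]_(x in A `|` B) f x = \int[mu]_(x in A) f x + \int[mu]_(x in B) f x.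
Proof.
move=> mA mB mf AB.
rewrite integralE [X in _ = X + _]integralE [X in _ = _ + X]integralE.
rewrite !ge0_integral_setU//;
  try by [exact: measurable_funepos|exact: measurable_funeneg].
have := @integral_ge0 _ T R mu A f^\+ (fun x _ => funepos_ge0 f x).
have := @integral_ge0 _ T R mu B f^\+ (fun x _ => funepos_ge0 f x).
have := @integral_ge0 _ T R mu A f^\- (fun x _ => funeneg_ge0 f x).
have := @integral_ge0 _ T R mu B f^\- (fun x _ => funeneg_ge0 f x).
case: (\int[mu]_(x in A) f^\+ x) => [a| |]//;
case: (\int[mu]_(x in B) f^\+ x) => [b| |]//;
case: (\int[mu]_(x in A) f^\- x) => [a'| |]//;
case: (\int[mu]_(x in B) f^\- x) => [b'| |]// _ _ _ _.
by rewrite /=; congr (_%:E); ring.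
Qed.

Lemma measurable_le_integral (A : set T) (f g : T -> \bar R) :
  measurable A -> measurable_fun A f -> measurable_fun A g ->
  (forall x, A x -> f x <= g x) ->
  \int[mu]_(x in A) f x <= \int[mu]_(x in A) g x.
Proof.
move=> mA mf mg fg; rewrite integralE [leRHS]integralE leeB//.
- apply: ge0_le_integral => //; [exact: measurable_funepos|exact: measurable_funepos|].
  by move=> x Ax; apply: (@funepos_le _ _ A) => //; [move=> y /set_mem; exact: fg|exact/mem_set].
- apply: ge0_le_integral => //; [exact: measurable_funeneg|exact: measurable_funeneg|].
  by move=> x Ax; apply: (@funeneg_le _ _ A) => //; [move=> y /set_mem; exact: fg|exact/mem_set].
Qed.

(** The integral is the difference of those of [f^\+] and [f^\-]. If either is infinite the
    difference is too, [+oo - +oo] being [-oo]. *)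
Lemma integral_fin_num_integrable (A : set T) (f : T -> \bar R) :
  measurable A -> measurable_fun A f ->
  \int[mu]_(x in A) f x \is a fin_num -> mu.-integrable A f.
Proof.
move=> mA mf; rewrite integralE => If; apply/integrableP; split => //.
under eq_integral do rewrite -/((abse \o f) _) fune_abse.
rewrite ge0_integralD//; [|exact: measurable_funepos|exact: measurable_funeneg].
have := @integral_ge0 _ T R mu A f^\+ (fun x _ => funepos_ge0 f x).
have := @integral_ge0 _ T R mu A f^\- (fun x _ => funeneg_ge0 f x).
move: If; case: (\int[mu]_(x in A) f^\+ x) => [a| |]//;
case: (\int[mu]_(x in A) f^\- x) => [b| |]// _ _ _.
by rewrite -EFinD ltry.
Qed.

Lemma measurable_integralZl (A : set T) (f : T -> \bar R) (k : R) :
  measurable A -> measurable_fun A f -> (0 < k)%R ->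
  \int[mu]_(x in A) (k%:E * f x) = k%:E * \int[mu]_(x in A) f x.
Proof.
move=> mA mf k0; rewrite integralE [in RHS]integralE.
rewrite ge0_funeposM ?ltW// ge0_funenegM ?ltW//.
rewrite !ge0_integralZl//; try by [exact: measurable_funepos|exact: measurable_funeneg|
  rewrite lee_fin ltW].
have := @integral_ge0 _ T R mu A f^\+ (fun x _ => funepos_ge0 f x).
have := @integral_ge0 _ T R mu A f^\- (fun x _ => funeneg_ge0 f x).
case: (\int[mu]_(x in A) f^\+ x) => [a| |]//;
case: (\int[mu]_(x in A) f^\- x) => [b| |]// _ _;
  rewrite ?gt0_muley ?gt0_muleNy ?lte_fin//=.
by congr (_%:E); ring.
Qed.

(** The difference [g - f] is nonnegative with integral 0, hence vanishes almost everywhere;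
    integrability makes both functions finite there. *)
Lemma le_integral_eq_ae (A : set T) (f g : T -> \bar R) :
  measurable A -> mu.-integrable A f -> mu.-integrable A g ->
  (forall x, A x -> f x <= g x) ->
  \int[mu]_(x in A) f x = \int[mu]_(x in A) g x ->
  {ae mu, forall x, A x -> f x \is a fin_num /\ f x = g x}.
Proof.
move=> mA iF iG fg IE.
have iD := integrableB mA iG iF.
have I0 : \int[mu]_(x in A) (g x - f x) = 0.
  by rewrite integralB// -IE subee// integrable_fin_num.
have aeF := integrable_ae mA iF; have aeG := integrable_ae mA iG.
have mD := measurable_int mu iD.
have I1 : \int[mu]_(x in A) `|g x - f x| = 0.
  rewrite -I0; apply: ae_eq_integral => //; first exact: measurableT_comp.
  apply: filterS2 aeF aeG => x f1 f2 Ax.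
  by rewrite gee0_abs// sube_ge0 ?f1 ?orbT// fg.
have /(ae_eq_integral_abs mu mA mD) aeE := I1.
apply: filterS3 aeF aeG aeE => x f1 f2 fE Ax; split; first exact: f1.
have /= := fE Ax; move: (f1 Ax) (f2 Ax).
case: (f x) => [a| |]//; case: (g x) => [b| |]// _ _ [] /eqP.
by rewrite subr_eq0 => /eqP ->.
Qed.

Lemma le_integral_linear (A : set T) (f g h : T -> \bar R) (a b : R) :
  measurable A -> mu.-integrable A f -> mu.-integrable A g -> measurable_fun A h ->
  (forall x, A x -> a%:E * f x + b%:E * g x <= h x) ->
  a%:E * \int[mu]_(x in A) f x + b%:E * \int[mu]_(x in A) g x <= \int[mu]_(x in A) h x.
Proof.
move=> mA iF iG mh fgh; rewrite -!integralZl//.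
have iaF := integrableZl mA a iF; have ibG := integrableZl mA b iG.
rewrite -integralD//; apply: measurable_le_integral => //.
exact: (measurable_int mu (integrableD mA iaF ibG)).
Qed.

Lemma integrable_fine (A : set T) (f : T -> \bar R) : measurable A ->
  mu.-integrable A f -> mu.-integrable A (EFin \o (fine \o f)) /\
  \int[mu]_(x in A) f x = (\int[mu]_(x in A) fine (f x))%:E.
Proof.
move=> mA iF; have mf := measurable_int mu iF.
have mff : measurable_fun A (EFin \o (fine \o f)).
  by apply/measurable_EFinP; apply: measurableT_comp mf.
have E : ae_eq mu A f (EFin \o (fine \o f)).
  have := integrable_ae mA iF; apply: filterS => x fx Ax.
  by rewrite /= fineK// fx.
have IE : \int[mu]_(x in A) f x = \int[mu]_(x in A) (fine (f x))%:E.
  exact: ae_eq_integral.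
split; last by rewrite /Rintegral -IE fineK// integrable_fin_num.
by apply: integral_fin_num_integrable => //; rewrite -IE integrable_fin_num.
Qed.

Lemma integrable_ae_eq (A : set T) (f g : T -> \bar R) : measurable A ->
  measurable_fun A g -> ae_eq mu A f g -> mu.-integrable A f -> mu.-integrable A g.
Proof.
move=> mA mg fg iF; have /integrableP[mf If] := iF; apply/integrableP; split=> //.
have <- : \int[mu]_(x in A) `|f x| = \int[mu]_(x in A) `|g x|; last exact: If.
apply: ae_eq_integral => //; [exact: measurableT_comp|exact: measurableT_comp|].
by move: fg; apply: filterS => x H Ax; rewrite H.
Qed.

End ExtendedIntegral.

(** * Translation invariance of the Lebesgue measure *)

Section Shift.
Context {R : realType}.
Local Notation leb := (@lebesgue_measure R).

Lemma measurable_shift (a : R) : measurable_fun setT (fun x : R => x + a).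
Proof. exact: measurable_funD. Qed.

(** The Lebesgue measure is determined by its values on half-open intervals, whose length a
    translation preserves. *)
Lemma lebesgue_measure_shift (a : R) (A : set R) : measurable A ->
  pushforward leb (fun x : R => x + a : measurableTypeR R) A = leb A.
Proof.
move=> mA.
apply/esym/lebesgue_measure_unique => //=; [exact: measurable_shift|move=> ms].
move=> _ [[x y]] _ <-.
rewrite /pushforward /=.
have -> : (fun x0 : R => x0 + a) @^-1` `]x, y] = `](x - a), (y - a)]%classic.
  by apply/seteqP; split=> z; rewrite /= !in_itv/= ltrBlDr lerBrDr.
rewrite !lebesgue_measure_itv/= !lte_fin ltrD2r.
by case: ifP => //; rewrite -!EFinB => _; congr _%:E; ring.
Qed.

Lemma ge0_integral_shift (a : R) (A : set R) (f : R -> \bar R) :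
  measurable A -> measurable_fun A f -> (forall x, A x -> 0 <= f x)%E ->
  (\int[leb]_(x in A) f x = \int[leb]_(x in (fun x : R => (x + a)%R) @^-1` A) f (x + a)%R)%E.
Proof.
move=> mA mf f0.
rewrite -[RHS](@ge0_integral_pushforward _ _ (measurableTypeR R) (measurableTypeR R) R
  _ (measurable_shift a))//; last by move=> y /set_mem /f0.
apply: eq_measure_integral => //= [|ms B mB _]; first exact: measurable_shift.
exact/esym/lebesgue_measure_shift.
Qed.

Lemma integral_shift (a : R) (A : set R) (f : R -> \bar R) :
  measurable A -> measurable_fun A f ->
  (\int[leb]_(x in A) f x = \int[leb]_(x in (fun x : R => (x + a)%R) @^-1` A) f (x + a)%R)%E.
Proof.
move=> mA mf; rewrite integralE [RHS]integralE.
rewrite (@ge0_integral_shift a A f^\+%E)//; last exact: measurable_funepos.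
rewrite (@ge0_integral_shift a A f^\-%E)//; last exact: measurable_funeneg.
by congr (_ - _)%E; apply: eq_integral => x _; rewrite !unlock.
Qed.

Lemma measurable_fun_shift d' (Y : measurableType d') (a : R) (A : set R) (f : R -> Y) :
  measurable A -> measurable_fun A f ->
  measurable_fun ((fun x : R => x + a) @^-1` A) (fun x => f (x + a)).
Proof.
move=> mA mf; apply: (measurable_comp mA) => //; first by move=> _ [x Ax <-].
by apply: measurable_funTS; exact: measurable_shift.
Qed.

Lemma integrable_shift (a : R) (A : set R) (f : R -> \bar R) :
  measurable A -> leb.-integrable A f ->
  leb.-integrable ((fun x : R => x + a) @^-1` A) (fun x => f (x + a)).
Proof.
move=> mA /integrableP[mf fi]; apply/integrableP; split.
  exact: measurable_fun_shift.
rewrite -(@ge0_integral_shift a A (fun x => `|f x|)%E)//.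
exact: measurableT_comp.
Qed.

End Shift.

(** * Utility functions *)

Section Utility.
Context {R : realType}.
Implicit Types gamma x y s : R.

(** The real-valued formula. It agrees with [utility] at positive arguments; at [0] it is a default
    value whenever [utility] is [-oo]. *)
Definition rutility gamma x : R :=
  if gamma == 1 then ln x else x `^ (1 - gamma) / (1 - gamma).

Lemma utility_gt0 gamma x : 0 < x -> utility gamma x = (rutility gamma x)%:E.
Proof.
move=> x0; rewrite /utility /rutility; case: ifP => _; first by rewrite lne_EFin.
by rewrite (gt_eqF x0) andbF.
Qed.

Lemma utility0_lt1 gamma : gamma < 1 -> utility gamma 0 = 0%E.
Proof.
move=> g1; rewrite /utility lt_eqF// ltNge (ltW g1)/= powR0 ?mul0r//.
by rewrite subr_eq0 gt_eqF.
Qed.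

Lemma utility0_ge1 gamma : 1 <= gamma -> utility gamma 0 = -oo%E.
Proof.
rewrite /utility le_eqVlt eq_sym; case: ifPn => [_ _|_ /= ->]; last by rewrite eqxx.
by rewrite le0_lneNy.
Qed.

(** Put [t = ln r] and bound [expR] from below, at the points [t] and [0], by its tangent at
    [al * t]. Averaging with weights [al] and [1 - al] cancels the terms linear in [t]; the bound at
    [t] is strict because [t != 0]. *)
Lemma powR_bernoulli_lt01 (al r : R) : 0 < al < 1 -> 0 < r -> r != 1 ->
  r `^ al < 1 + al * (r - 1).
Proof.
move=> /andP[a0 a1] r0 r1; rewrite /powR gt_eqF//.
have rE : r = expR (ln r) by rewrite lnK.
set t := ln r in rE *.
have t0 : t != 0 by apply: contra_neq r1 => t0; rewrite rE t0 expR0.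
have e1 : expR (al * t) * (1 + (1 - al) * t) < expR t.
  rewrite [ltRHS](_ : _ = expR (al * t) * expR ((1 - al) * t)); last first.
    by rewrite -expRD; congr expR; ring.
  rewrite ltr_pM2l ?expR_gt0// expR_gt1Dx// mulf_neq0// subr_eq0 gt_eqF//.
have e2 : expR (al * t) * (1 - al * t) <= 1.
  rewrite -[leRHS](_ : expR (al * t) * expR (- (al * t)) = _); last first.
    by rewrite -expRD subrr expR0.
  by rewrite ler_pM2l ?expR_gt0// expR_ge1Dx.
rewrite rE; set E := expR (al * t) in e1 e2 *; set F := expR t in e1 *.
have := ltr_pM2l a0 (E * (1 + (1 - al) * t)) F; rewrite e1 => /idP h1.
have a1' : 0 < 1 - al by rewrite subr_gt0.
have := ler_pM2l a1' (E * (1 - al * t)) 1; rewrite e2 => /idP h2.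
lra.
Qed.

(** Multiplying [ln r < r - 1] by the negative [al] reverses it, and [1 + al * ln r] is a lower
    bound of the exponential of [al * ln r]. *)
Lemma powR_bernoulli_lt0 (al r : R) : al < 0 -> 0 < r -> r != 1 ->
  1 + al * (r - 1) < r `^ al.
Proof.
move=> a0 r0 r1; rewrite /powR gt_eqF//.
have rE : r = expR (ln r) by rewrite lnK.
set t := ln r in rE *.
have t0 : t != 0 by apply: contra_neq r1 => t0; rewrite rE t0 expR0.
have e1 := expR_gt1Dx t0.
have e2 := expR_ge1Dx (al * t).
have na0 : 0 < - al by rewrite oppr_gt0.
have := ltr_pM2l na0 (1 + t) (expR t); rewrite e1 => /idP h1.
by rewrite rE; lra.
Qed.

(** Strict concavity in tangent form. Homogeneity reduces it to the ratio [r = y / x]: for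
    [gamma = 1] it is [ln r < r - 1], otherwise one of the two Bernoulli inequalities divided by
    [1 - gamma], whose sign turns the second one around. *)
Lemma rutility_tangent_lt gamma x y : 0 < gamma -> 0 < x -> 0 < y -> y != x ->
  rutility gamma y < rutility gamma x + x `^ (- gamma) * (y - x).
Proof.
move=> g0 x0 y0 yx; rewrite /rutility.
have xn0 : x != 0 by rewrite gt_eqF.
have r0 : 0 < y / x by rewrite divr_gt0.
have r1 : y / x != 1 by apply: contra_neq yx => /divr1_eq.
have yE : y = x * (y / x) by field.
case: ifPn => [/eqP->|g1].
  have l0 : ln (y / x) != 0.
    by apply: contra_neq r1 => l0; rewrite -[LHS]lnK// l0 expR0.
  have := expR_gt1Dx l0; rewrite lnK// => h.
  rewrite {1}yE lnM// powRN powRr1 ?(ltW x0)//.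
  have -> : x^-1 * (y - x) = y / x - 1 by field.
  lra.
have yE' : y `^ (1 - gamma) = x `^ (1 - gamma) * (y / x) `^ (1 - gamma).
  by rewrite -powRM ?ltW// -yE.
have xE : x `^ (- gamma) * (y - x) = x `^ (1 - gamma) * (y / x - 1).
  by rewrite powRD ?xn0 ?implybT// powRr1 ?ltW//; field.
rewrite yE' xE; set X := x `^ _; set r := y / x.
have X0 : 0 < X by rewrite powR_gt0.
rewrite -!mulrA -mulrDr ltr_pM2l//.
have al0 : 1 - gamma != 0 by rewrite subr_eq0 eq_sym.
have -> : (1 - gamma)^-1 + (r - 1) = (1 + (1 - gamma) * (r - 1)) / (1 - gamma).
  by field.
case: (ltgtP gamma 1) => [gl|gg|gE].
- rewrite ltr_pM2r ?invr_gt0 ?subr_gt0// powR_bernoulli_lt01//.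
  by apply/andP; split; lra.
- rewrite ltr_nM2r ?invr_lt0 ?subr_lt0// powR_bernoulli_lt0// ?subr_lt0//.
- by rewrite gE eqxx in g1.
Qed.

(** The new case is [y = 0]. There the utility is [-oo] if [1 <= gamma]; if [gamma < 1] it is [0],
    while the tangent takes the value x^(1 - gamma) times 1/(1 - gamma) - 1, which is positive. *)
Lemma utility_tangent_lt gamma x y : 0 < gamma -> 0 < x -> 0 <= y -> y != x ->
  (utility gamma y < (rutility gamma x + x `^ (- gamma) * (y - x))%:E)%E.
Proof.
move=> g0 x0; rewrite le_eqVlt => /predU1P[<- _|y0 yx]; last first.
  by rewrite utility_gt0// lte_fin rutility_tangent_lt.
have [g1|g1] := leP 1 gamma; first by rewrite utility0_ge1// ltNyr.
have xn0 : x != 0 by rewrite gt_eqF.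
rewrite utility0_lt1// lte_fin /rutility lt_eqF//.
have xE : x `^ (- gamma) * (0 - x) = - x `^ (1 - gamma).
  by rewrite powRD ?xn0 ?implybT// powRr1 ?ltW//; ring.
rewrite xE -[X in _ - X]mulr1 -mulrBr mulr_gt0 ?powR_gt0//.
have al0 : 0 < 1 - gamma by rewrite subr_gt0.
by rewrite subr_gt0 invf_gt1//; lra.
Qed.

Lemma utility_tangent gamma x y : 0 < gamma -> 0 < x -> 0 <= y ->
  (utility gamma y <= (rutility gamma x + x `^ (- gamma) * (y - x))%:E)%E.
Proof.
move=> g0 x0 y0; have [->|yx] := eqVneq y x.
  by rewrite utility_gt0// subrr mulr0 addr0.
exact/ltW/utility_tangent_lt.
Qed.

Lemma utility_ge0_cases gamma x : 0 <= x ->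
  utility gamma x = -oo%E \/ exists r, utility gamma x = r%:E.
Proof.
rewrite le_eqVlt => /predU1P[<-|x0]; last by right; exists (rutility gamma x); rewrite utility_gt0.
have [g1|g1] := leP 1 gamma; first by left; rewrite utility0_ge1.
by right; exists 0; rewrite utility0_lt1.
Qed.

Lemma utility_incr gamma x y : 0 < gamma -> 0 <= x -> x < y ->
  (utility gamma x < utility gamma y)%E.
Proof.
move=> g0 x0 xy; have y0 := le_lt_trans x0 xy.
apply: (lt_le_trans (utility_tangent_lt g0 y0 x0 _)); first by rewrite lt_eqF.
rewrite utility_gt0// lee_fin gerDl nmulr_lle0 ?subr_lt0//.
exact: powR_ge0.
Qed.

(** Both endpoints lie below the tangent at the intermediate point [z]. When [x < y] this point is
    positive even if [x = 0], so the tangent exists. *)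
Lemma utility_concave gamma x y s : 0 < gamma -> 0 <= x -> x <= y -> 0 < s -> s < 1 ->
  ((1 - s)%:E * utility gamma x + s%:E * utility gamma y
    <= utility gamma (x + s * (y - x)))%E.
Proof.
move=> g0 x0; rewrite le_eqVlt => /predU1P[<- s0 s1|xy s0 s1].
  rewrite subrr mulr0 addr0; have [->|[r ->]] := utility_ge0_cases gamma x0.
    by rewrite gt0_muleNy ?addNye ?leNye// lte_fin subr_gt0.
  by rewrite -!EFinM -EFinD lee_fin; lra.
have y0 := le_lt_trans x0 xy.
set z := x + s * (y - x).
have z0 : 0 < z by rewrite ltr_wpDl// mulr_gt0// subr_gt0.
have := utility_tangent g0 z0 x0; have := utility_tangent g0 z0 (ltW y0).
rewrite (utility_gt0 gamma z0).
have [->|[r ->]] := utility_ge0_cases gamma x0.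
  by move=> _ _; rewrite gt0_muleNy ?addNye ?leNye// lte_fin subr_gt0.
rewrite (utility_gt0 gamma y0) -!EFinM -EFinD !lee_fin.
set D := z `^ _; set U := rutility gamma z; set W := rutility gamma y => h1 h2.
have h1' : s * W <= s * (U + D * (y - z)) by rewrite ler_pM2l.
have h2' : (1 - s) * r <= (1 - s) * (U + D * (x - z)) by rewrite ler_pM2l ?subr_gt0.
apply: le_trans (lerD h2' h1') _.
by rewrite le_eqVlt; apply/orP; left; apply/eqP; rewrite /z; ring.
Qed.

(** The tangent at [1] has slope 1. Linear growth makes the utility of a locally integrable control
    bounded above by an integrable function. *)
Lemma utility_le_linear gamma x : 0 < gamma -> 0 <= x ->
  (utility gamma x <= (rutility gamma 1 + x)%:E)%E.
Proof.
move=> g0 x0; apply: (le_trans (utility_tangent g0 ltr01 x0)).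
by rewrite lee_fin powR1 lerD2l mul1r gerBl.
Qed.

Lemma measurable_utility gamma : measurable_fun [set: R] (utility gamma).
Proof.
rewrite /utility; case: (gamma == 1).
  apply: measurable_fun_if => //=.
  - by apply: measurable_fun_ler.
  - by apply: measurable_funTS; apply/measurable_EFinP; exact: measurable_ln.
case: (1 < gamma) => /=; last first.
  apply/measurable_EFinP; apply: measurable_funM => //; exact: measurable_powR.
apply: measurable_fun_if => //=.
- by apply: measurable_fun_eqr.
- apply: measurable_funTS; apply/measurable_EFinP; apply: measurable_funM => //; exact: measurable_powR.
Qed.

End Utility.

(** * Linear flows *)

Section ExponentialSeries.
Context {R : realType}.
Implicit Types (c : R^nat) (B W x t : R).

Lemma is_cvg_pseries_exp c B W x : 0 <= B -> 0 <= W ->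
  (forall m, `|c m| <= W * (B ^+ m / m`!%:R)) -> cvgn (pseries c x).
Proof.
move=> B0 W0 cB; apply: normed_cvg.
apply: (@series_le_cvg _ _ (fun m => W * exp_coeff (B * `|x|) m)).
- by move=> m; exact: normr_ge0.
- by move=> m /=; rewrite mulr_ge0// exp_coeff_ge0// mulr_ge0.
- move=> m; rewrite /exp_coeff/= normrM normrX exprMn.
  rewrite [leRHS](_ : _ = W * (B ^+ m / m`!%:R) * `|x| ^+ m); last by ring.
  by rewrite ler_wpM2r// exprn_ge0.
- by apply: (@is_cvg_seriesZ _ (exp_coeff (B * `|x|)) W); exact: is_cvg_series_exp_coeff.
Qed.

Lemma lim_pseries0 c : limn (pseries c 0) = c 0%N.
Proof.
apply/cvg_lim => //; apply: cvg_near_cst; exists 1%N => // m /= m1.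
rewrite /pseries /series /= big_ltn// expr0 mulr1 big_nat_cond big1 ?addr0// => i.
by rewrite andbT => /andP[i0 _]; rewrite expr0n gtn_eqF ?mulr0.
Qed.

Lemma lim_pseries_ge0 c x : cvgn (pseries c x) -> 0 <= x -> (forall m, 0 <= c m) ->
  0 <= limn (pseries c x).
Proof.
move=> cvc x0 c0; apply: limr_ge => //; apply: nearW => m.
by apply: sumr_ge0 => i _; rewrite mulr_ge0// exprn_ge0.
Qed.

End ExponentialSeries.

(** The hypothesis is one-sided because the comparisons it serves hold only for nonnegative times or
    step sizes. *)
Lemma is_derive_right_ge0 {R : realType} (f : R -> R) (x d : R) :
  is_derive x (1 : R) f d -> (\forall h \near 0^'+, f x <= f (h + x)) -> 0 <= d.
Proof.
move=> [df <-] fx.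
have cf : (h^-1 *: (f (h *: 1 + x) - f x)) @[h --> 0^'+] --> 'D_1 f x.
  by apply: cvg_dnbhs_at_right; exact: df.
rewrite -(cvg_lim _ cf)//; apply: limr_ge; first by apply/cvg_ex; eexists; exact: cf.
near=> h; rewrite /GRing.scale/= mulr1 mulr_ge0 ?invr_ge0// subr_ge0.
by near: h.
Unshelve. all: by end_near. Qed.

Section LinearFlow.
Context {R : realType} {n : nat}.
Implicit Types (P M : 'M[R]_n) (w : 'cV[R]_n) (t : R).

(** One scalar power series per coordinate, so that termwise differentiation of [pseries] applies
    directly. *)
Definition flow_coef P w (i : 'I_n) (m : nat) : R :=
  (iter m (mulmx P) w) i 0 / m`!%:R.

Definition flow_int_coef P w (i : 'I_n) (m : nat) : R :=
  if m is m'.+1 then (iter m' (mulmx P) w) i 0 / m`!%:R else 0.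

(* [flow P w t] is e^(tP) w and [flow_int P w t] its integral over [0, t]. *)
Definition flow P w t : 'cV[R]_n := \col_i limn (pseries (flow_coef P w i) t).

Definition flow_int P w t : 'cV[R]_n := \col_i limn (pseries (flow_int_coef P w i) t).

Lemma norm_iter_mulmx P w : exists B W : R, [/\ 1 <= B, 0 <= W &
  forall m i, `|(iter m (mulmx P) w) i 0| <= W * B ^+ m].
Proof.
(* The summand 1 gives [1 <= B]: coefficient [m.+1] of [flow_int] involves only the [m]-th power of
   [P], and [B ^+ m <= B ^+ m.+1] brings it under the same bound. *)
pose B := 1 + \sum_i \sum_j `|P i j|; pose W := \sum_i `|w i 0|.
have B1 : 1 <= B by rewrite lerDl sumr_ge0// => i _; rewrite sumr_ge0.
have W0 : 0 <= W by rewrite sumr_ge0.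
exists B, W; split=> //; elim=> [i|m IH i] /=.
  rewrite expr0 mulr1 /W (bigD1 i)//= lerDl sumr_ge0//.
rewrite mxE; apply: le_trans (ler_norm_sum _ _ _) _.
apply: (@le_trans _ _ (\sum_j `|P i j| * (W * B ^+ m))).
  by apply: ler_sum => j _; rewrite normrM ler_wpM2l.
rewrite -mulr_suml exprS [leRHS]mulrCA.
have WB : 0 <= W * B ^+ m by rewrite mulr_ge0// exprn_ge0// (le_trans ler01).
apply: ler_wpM2r => //.
apply: (@le_trans _ _ (\sum_i \sum_j `|P i j|)); last by rewrite /B lerDr.
by rewrite [leRHS](bigD1 i)//= lerDl sumr_ge0// => k _; rewrite sumr_ge0.
Qed.

Lemma is_cvg_flow P w i t : cvgn (pseries (flow_coef P w i) t).
Proof.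
have [B [W [B1 W0 H]]] := norm_iter_mulmx P w.
apply: (@is_cvg_pseries_exp _ _ B W) => //; first exact: le_trans B1.
move=> m; rewrite normrM normfV [`|_`!%:R|]ger0_norm// mulrA ler_wpM2r// invr_ge0.
Qed.

Lemma is_cvg_flow_int P w i t : cvgn (pseries (flow_int_coef P w i) t).
Proof.
have [B [W [B1 W0 H]]] := norm_iter_mulmx P w.
have B0 : 0 <= B by exact: le_trans B1.
apply: (@is_cvg_pseries_exp _ _ B W) => // -[|m] /=.
  by rewrite normr0 mulr_ge0// divr_ge0 ?exprn_ge0.
rewrite normrM normfV [`|_`!%:R|]ger0_norm// mulrA ler_wpM2r ?invr_ge0//.
apply: le_trans (H m i) _; rewrite ler_wpM2l// exprS ler_peMl//.
exact: exprn_ge0.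
Qed.

Lemma diffs_flow_coef P w i :
  pseries_diffs (flow_coef P w i) = flow_coef P (P *m w) i.
Proof.
apply/funext => m; rewrite /pseries_diffs /flow_coef -iterSr factS natrM.
have m0 : m.+1%:R != 0 :> R by [].
have f0 : m`!%:R != 0 :> R by rewrite pnatr_eq0 -lt0n fact_gt0.
by field; rewrite f0 addrC natr1 m0.
Qed.

Lemma diffs_flow_int_coef P w i :
  pseries_diffs (flow_int_coef P w i) = flow_coef P w i.
Proof.
apply/funext => m; rewrite /pseries_diffs /flow_coef /flow_int_coef factS natrM.
have m0 : m.+1%:R != 0 :> R by [].
have f0 : m`!%:R != 0 :> R by rewrite pnatr_eq0 -lt0n fact_gt0.
by field; rewrite f0 addrC natr1 m0.
Qed.

Lemma is_derive_flow P w i t :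
  is_derive t (1 : R) (fun s => flow P w s i 0) (flow P (P *m w) t i 0).
Proof.
rewrite (_ : (fun s => _) = (fun s => limn (pseries (flow_coef P w i) s))); last first.
  by apply/funext => s; rewrite mxE.
rewrite mxE -diffs_flow_coef; apply: (@pseries_snd_diffs _ _ (`|t| + 1)).
- exact: is_cvg_flow.
- by rewrite diffs_flow_coef; exact: is_cvg_flow.
- by rewrite !diffs_flow_coef; exact: is_cvg_flow.
- by rewrite [ltRHS]ger0_norm ?addr_ge0// ltrDl.
Qed.

Lemma is_derive_flow_int P w i t :
  is_derive t (1 : R) (fun s => flow_int P w s i 0) (flow P w t i 0).
Proof.
rewrite (_ : (fun s => _) = (fun s => limn (pseries (flow_int_coef P w i) s))); last first.
  by apply/funext => s; rewrite mxE.
rewrite mxE -diffs_flow_int_coef; apply: (@pseries_snd_diffs _ _ (`|t| + 1)).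
- exact: is_cvg_flow_int.
- by rewrite diffs_flow_int_coef; exact: is_cvg_flow.
- by rewrite diffs_flow_int_coef diffs_flow_coef; exact: is_cvg_flow.
- by rewrite [ltRHS]ger0_norm ?addr_ge0// ltrDl.
Qed.

Lemma flow0 P w : flow P w 0 = w.
Proof.
by apply/colP => i; rewrite mxE lim_pseries0 /flow_coef/= fact0 divr1.
Qed.

Lemma flow_int0 P w : flow_int P w 0 = 0.
Proof. by apply/colP => i; rewrite !mxE lim_pseries0. Qed.

Lemma iter_mulmxr P w m : iter m (mulmx P) (P *m w) = P *m iter m (mulmx P) w.
Proof. by rewrite -iterSr iterS. Qed.

Lemma cvg_flow P w i t : pseries (flow_coef P w i) t @ \oo --> flow P w t i 0.
Proof. by rewrite mxE; exact: is_cvg_flow. Qed.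

Lemma mulmx_flow P w t : P *m flow P w t = flow P (P *m w) t.
Proof.
apply/colP => i; rewrite !mxE.
have h : \sum_j P i j * pseries (flow_coef P w j) t m @[m --> \oo] -->
         \sum_j P i j * flow P w t j 0.
  apply: cvg_big => [|j _]; first exact: add_continuous.
  by apply: cvgMl_tmp; exact: cvg_flow.
apply/esym/cvg_lim => //.
rewrite (_ : pseries _ _ = fun m => \sum_j P i j * pseries (flow_coef P w j) t m)//.
apply/funext => m; rewrite /pseries /series/= /flow_coef.
under eq_bigr do rewrite iter_mulmxr mxE.
under [RHS]eq_bigr do rewrite mulr_sumr.
rewrite [RHS]exchange_big/=; apply: eq_bigr => k _.
by rewrite !mulr_suml; apply: eq_bigr => j _; ring.
Qed.

(** Both [P *m flow_int] and [flow] have derivative [flow P (P *m w)], so their difference keeps its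
    value [- w] at time 0. *)
Lemma mulmx_flow_int P w t : P *m flow_int P w t = flow P w t - w.
Proof.
apply/colP => i.
pose f s := (P *m flow_int P w s) i 0 - flow P w s i 0.
have df (s : R) : is_derive s (1 : R) f 0.
  rewrite /f (_ : (fun s => _) = \sum_j (fun s => P i j * flow_int P w s j 0) -
      (fun s => flow P w s i 0)); last first.
    by apply/funext => x; rewrite fctE/= fct_sumE mxE.
  have -> : 0 = \sum_j P i j * flow P w s j 0 - flow P (P *m w) s i 0.
    by rewrite -mulmx_flow mxE subrr.
  apply: is_deriveB; last exact: is_derive_flow.
  apply: is_derive_sum => j.
  have := is_derive_flow_int P w j s.
  exact: is_deriveZ.
have := is_derive_0_is_cst t 0 df.
rewrite /f flow0 flow_int0 mulmx0 [(0 : 'cV_n) i 0]mxE sub0r => /eqP.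
by rewrite subr_eq => /eqP ->; rewrite [RHS]mxE [(- w) i 0]mxE addrC.
Qed.

Lemma iter_mulmx_ge0 P w m i : (forall i j, 0 <= P i j) -> orthant w ->
  0 <= (iter m (mulmx P) w) i 0.
Proof.
move=> P0 w0; elim: m i => [|m IH] i //=; rewrite mxE sumr_ge0// => j _.
by rewrite mulr_ge0.
Qed.

Lemma flow_ge0 P w t : (forall i j, 0 <= P i j) -> orthant w -> 0 <= t ->
  orthant (flow P w t).
Proof.
move=> P0 w0 t0 i; rewrite mxE lim_pseries_ge0//; first exact: is_cvg_flow.
by move=> m; rewrite divr_ge0 ?iter_mulmx_ge0.
Qed.

(** Corresponding terms of the two series have ratio t / (k + 1), at most 1 for t <= 1, and all
    terms are nonnegative. This bound is what keeps the perturbed state of [admissible_impulse] in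
    the orthant. *)
Lemma flow_int_le_flow P w t i : (forall i j, 0 <= P i j) -> orthant w ->
  0 <= t -> t <= 1 -> flow_int P w t i 0 <= flow P w t i 0.
Proof.
move=> P0 w0 t0 t1.
(* One more term is taken on this side: the zeroth coefficient of [flow_int] is 0, and after
   dropping it the partial sums match term by term. *)
have c1 : pseries (flow_int_coef P w i) t m.+1 @[m --> \oo] --> flow_int P w t i 0.
  by rewrite cvg_shiftS mxE; exact: is_cvg_flow_int.
apply: (ler_cvg_to c1 (@cvg_flow P w i t)); apply: nearW => m.
rewrite /pseries /series/= big_nat_recl//= mul0r add0r ler_sum// => k _.
rewrite /flow_int_coef /flow_coef factS natrM exprS.
have f0 : 0 < k`!%:R :> R by rewrite ltr0n fact_gt0.
have k0 : 0 < k.+1%:R :> R by rewrite ltr0n.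
set X := (iter k (mulmx P) w) i 0.
rewrite [leLHS](_ : _ = X / k`!%:R * t ^+ k * (t / k.+1%:R)); last first.
  by field; rewrite !gt_eqF//= addrC natr1.
rewrite ler_piMr//.
  by rewrite mulr_ge0 ?exprn_ge0// divr_ge0 ?(ltW f0)//; exact: iter_mulmx_ge0 P0 w0.
by rewrite ler_pdivrMr// mul1r (le_trans t1)// ler1n.
Qed.

Lemma cvg_mx_entries (F : nat -> 'M[R]_n) (G : 'M[R]_n) :
  (forall i j, F m i j @[m --> \oo] --> G i j) -> F m @[m --> \oo] --> G.
Proof.
move=> FG; apply/cvgrPdist_le => /= e e0; near=> m.
rewrite [leLHS]/Num.Def.normr/= mx_normrE (bigmax_le _ (ltW e0))//= => -[i j] _.
rewrite !mxE/=; move: i j; near: m.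
apply: filter_forall => i; apply: filter_forall => j.
exact: ((cvgrPdist_le _ _).1 (FG i j)).
Unshelve. all: by end_near. Qed.

Lemma expmx_flow M t i j : expmx (t *: M) i j = flow M (delta_mx j 0) t i 0.
Proof.
have -> : expmx (t *: M) = \matrix_(i, j) flow M (delta_mx j 0) t i 0; last by rewrite mxE.
apply/cvg_lim => //; apply: cvg_mx_entries => {}i {}j; rewrite [X in _ --> X]mxE.
rewrite (_ : (fun m => _) = pseries (flow_coef M (delta_mx j 0) i) t).
  exact: cvg_flow.
apply/funext => m; rewrite /pseries /series/= summxE; apply: eq_bigr => k _.
rewrite /flow_coef mxE; have -> : (t *: M) ^+ k = t ^+ k *: M ^+ k.
  elim: k => [|k IH]; first by rewrite !expr0 scale1r.
  by rewrite !exprS IH -!mulmxE -scalemxAl -scalemxAr scalerA.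
have -> : iter k (mulmx M) (delta_mx j 0 : 'cV_n) i 0 = (M ^+ k) i j.
  have -> : iter k (mulmx M) (delta_mx j 0 : 'cV_n) = M ^+ k *m (delta_mx j 0 : 'cV_n).
    elim: k => [|k IH]; first by rewrite expr0 mul1mx.
    by rewrite iterS IH exprS -mulmxE mulmxA.
  by rewrite -colE mxE.
by rewrite !mxE; ring.
Qed.

(** For [i != j] the entry (i, j) of e^(tM) is 0 at t = 0 and nonnegative afterwards; its derivative
    at 0 is [M i j]. *)
Lemma expmx_preserves_offdiag M :
  (forall t, 0 <= t -> preserves_orthant (expmx (t *: M))) ->
  forall i j, i != j -> 0 <= M i j.
Proof.
move=> H i j ij.
pose f t := flow M (delta_mx j 0) t i 0.
have f_ge0 t : 0 <= t -> 0 <= f t.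
  move=> t0; have := H t t0 (delta_mx j 0) _ i; rewrite -colE mxE expmx_flow; apply.
  by move=> k; rewrite mxE ler0n.
have f0 : f 0 = 0 by rewrite /f flow0 mxE (negbTE ij).
have := is_derive_flow M (delta_mx j 0) i 0; rewrite flow0 -colE [col _ _ _ _]mxE.
move/is_derive_right_ge0; apply; near=> h; rewrite addr0 -/(f 0) -/(f h) f0.
exact: f_ge0.
Unshelve. all: by end_near. Qed.

End LinearFlow.

(** * Concatenation of controls and trajectories *)

Section LocallyIntegrable.
Context {R : realType}.
Local Notation leb := (@lebesgue_measure R).
Implicit Types (f g : R -> R) (a t T : R).

Definition concat (X : Type) (a : R) (f g : R -> X) (t : R) : X :=
  if t < a then f t else g (t - a).

Definition loc_integrable f := forall T, 0 <= T -> leb.-integrable `[0, T] (EFin \o f).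

Lemma loc_integrable_eq f g : (forall t, 0 <= t -> f t = g t) ->
  loc_integrable f -> loc_integrable g.
Proof.
move=> fg lf T T0; apply: eq_integrable (lf T T0) => // t.
by rewrite inE/= in_itv/= => /andP[t0 _]; rewrite fg.
Qed.

Lemma loc_integrableD f g : loc_integrable f -> loc_integrable g ->
  loc_integrable (fun t => f t + g t).
Proof.
move=> lf lg T T0.
by apply: eq_integrable (integrableD _ (lf T T0) (lg T T0)).
Qed.

Lemma loc_integrableZ (k : R) f : loc_integrable f -> loc_integrable (fun t => k * f t).
Proof.
move=> lf T T0.
by apply: eq_integrable (integrableZl _ k (lf T T0)).
Qed.

Lemma loc_integrable_sum (m : nat) (F : 'I_m -> R -> R) :
  (forall i, loc_integrable (F i)) -> loc_integrable (fun t => \sum_i F i t).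
Proof.
move=> lF T T0.
have := @integrable_sum _ _ _ leb _ (measurable_itv `[0, T]) _ (index_enum 'I_m) xpredT
  (fun i => EFin \o F i) (fun i _ => lF i T T0).
by apply: eq_integrable => // t _; rewrite /= sumEFin.
Qed.

Lemma within_continuous_loc_integrable f :
  {within `[0, +oo[, continuous f} -> loc_integrable f.
Proof.
move=> cf T T0; apply: continuous_compact_integrable; first exact: segment_compact.
by apply: continuous_subspaceW cf => t; rewrite /= !in_itv/= => /andP[->].
Qed.

Lemma preimage_shift_cc a T :
  (fun x : R => x + a) @^-1` `[a, a + T]%classic = `[0, T]%classic.
Proof.
by apply/seteqP; split=> t; rewrite /= !in_itv/= lerDr [a + T]addrC lerD2r.
Qed.

Lemma loc_integrable_shift a f : 0 <= a -> loc_integrable f ->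
  loc_integrable (fun t => f (t + a)).
Proof.
move=> a0 lf T T0; rewrite -(preimage_shift_cc a).
apply: (@integrable_shift _ a _ (EFin \o f)) => //.
apply: integrableS (lf (a + T) _) => //; last exact: addr_ge0.
by move=> t; rewrite /= !in_itv/= => /andP[at_ ->]; rewrite (le_trans a0).
Qed.

Lemma Rintegral_split_shift a t f : 0 <= a -> 0 <= t -> loc_integrable f ->
  \int[leb]_(s in `[0, a + t]) f s =
  \int[leb]_(s in `[0, a]) f s + \int[leb]_(s in `[0, t]) f (s + a).
Proof.
move=> a0 t0 lf; have at0 : 0 <= a + t by exact: addr_ge0.
have := @Rintegral_itvB _ f (BLeft 0) (BRight (a + t)) a (lf _ at0).
rewrite !bnd_simp a0 lerDl t0 => /(_ isT isT)/eqP; rewrite subr_eq => /eqP ->.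
rewrite addrC; congr (_ + _).
rewrite Rintegral_itv_obnd_cbnd; last first.
  apply: integrableS (lf _ at0) => // s.
  by rewrite /= !in_itv/= => /andP[/ltW sa ->]; rewrite (le_trans a0).
rewrite /Rintegral (@integral_shift _ a) ?preimage_shift_cc//.
apply: (measurable_int leb).
apply: integrableS (lf _ at0) => // s.
by rewrite /= !in_itv/= => /andP[sa ->]; rewrite (le_trans a0).
Qed.

Lemma loc_integrable_concat a f g : 0 <= a -> loc_integrable f -> loc_integrable g ->
  loc_integrable (concat a f g).
Proof.
move=> a0 lf lg T T0.
have aT0 : 0 <= a + T by exact: addr_ge0.
have m1 : measurable (`[0, a[%classic : set R) by [].
(* The second piece runs up to [a + T], so that the union covers [[0, T]] whichever of [a] and [T]
   is larger. *)
have m2 : measurable (`[a, a + T]%classic : set R) by [].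
have i1 : leb.-integrable `[0, a[ (EFin \o concat a f g).
  apply: (@eq_integrable _ _ _ leb _ _ (EFin \o f)) => //.
    by move=> t; rewrite inE/= in_itv/= /concat => /andP[_ ->].
  apply: integrableS (lf a a0) => // t.
  by rewrite /= !in_itv/= => /andP[-> /ltW ->].
have i2 : leb.-integrable `[a, a + T] (EFin \o concat a f g).
  have := @integrable_shift _ (- a) _ (EFin \o g) (measurable_itv `[0, T]) (lg T T0).
  have -> : (fun x : R => x - a) @^-1` `[0, T]%classic = `[a, a + T]%classic.
    by apply/seteqP; split=> t; rewrite /= !in_itv/= subr_ge0 lerBlDl.
  apply: eq_integrable => // t; rewrite inE/= in_itv/= /concat => /andP[].
  by rewrite leNgt => /negbTE -> _.
have sU : `[0, T] `<=` (`[0, a[ `|` `[a, a + T] : set R).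
  move=> t; rewrite /= !in_itv/= => /andP[t0 tT]; rewrite t0/=.
  by case: (ltP t a) => ta; [left|right]; rewrite //= (le_trans tT)// lerDr.
apply: (@integrableS _ _ _ leb (`[0, a[ `|` `[a, a + T])) => //; first exact: measurableU.
move/integrableP : i1 => [mi1 fi1]; move/integrableP : i2 => [mi2 fi2].
have mU : measurable_fun (`[0, a[ `|` `[a, a + T] : set R) (EFin \o concat a f g).
  by apply/measurable_funU.
apply/integrableP; split => //.
rewrite ge0_integral_setU//; first exact: lte_add_pinfty.
  exact: measurableT_comp.
apply/disj_setPLR => t; rewrite /= !in_itv/= => /andP[_ ta].
by rewrite leNgt ta.
Qed.

Lemma Rintegral_concat_lt a t f g : t < a ->
  \int[leb]_(s in `[0, t]) concat a f g s = \int[leb]_(s in `[0, t]) f s.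
Proof.
move=> ta; apply: eq_Rintegral => s; rewrite inE/= in_itv/= => /andP[_ st].
by rewrite /concat (le_lt_trans st ta).
Qed.

Lemma Rintegral_concat_ge a t f g : 0 <= a -> a <= t ->
  loc_integrable f -> loc_integrable g ->
  \int[leb]_(s in `[0, t]) concat a f g s =
  \int[leb]_(s in `[0, a]) f s + \int[leb]_(s in `[0, t - a]) g s.
Proof.
move=> a0 at_ lf lg; have lc := loc_integrable_concat a0 lf lg.
have ta0 : 0 <= t - a by rewrite subr_ge0.
have -> : \int[leb]_(s in `[0, t]) concat a f g s =
    \int[leb]_(s in `[0, a]) concat a f g s + \int[leb]_(s in `[0, t - a]) concat a f g (s + a).
  by rewrite -Rintegral_split_shift// addrC subrK.
congr (_ + _); last first.
  apply: eq_Rintegral => s; rewrite inE/= in_itv/= => /andP[s0 _].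
  by rewrite /concat ltNge lerDr s0/= addrK.
have sub : (`[0, a[ : set R) `<=` `[0, a].
  by move=> s; rewrite /= !in_itv/= => /andP[-> /ltW].
rewrite -Rintegral_itv_bndo_bndc; last by apply: integrableS (lc a a0).
rewrite -[RHS]Rintegral_itv_bndo_bndc; last by apply: integrableS (lf a a0).
apply: eq_Rintegral => s; rewrite inE/= in_itv/= => /andP[_ sa].
by rewrite /concat sa.
Qed.

End LocallyIntegrable.

Section ChainRule.
Context {R : realType} {n : nat}.

Lemma is_derive_col (X : R -> 'cV[R]_n) (X' : 'cV[R]_n) (t : R) :
  (forall i, is_derive t (1 : R) (fun s => X s i 0) (X' i 0)) ->
  is_derive t (1 : R) X X'.
Proof.
move=> dX.
have DX : derivable X t 1 by apply/derivable_mxP => i j; rewrite (ord1 j); have [] := dX i.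
split=> //; rewrite derive_mx//; apply/colP => i; rewrite mxE.
by have [_ ->] := dX i.
Qed.

Lemma is_derive_gradient (v : 'cV[R]_n -> R) (X : R -> 'cV[R]_n) (X' : 'cV[R]_n) (t : R) :
  differentiable v (X t) ->
  (forall i, is_derive t (1 : R) (fun s => X s i 0) (X' i 0)) ->
  is_derive t (1 : R) (v \o X) (\sum_i gradient v (X t) i 0 * X' i 0).
Proof.
move=> dv /is_derive_col[DX DXE].
have dX : differentiable X t by exact/derivable1_diffP.
have dvX : differentiable (v \o X) t by exact: differentiable_comp.
split; first exact/derivable1_diffP.
rewrite deriveE// diff_comp//=; have -> : 'd X t 1 = X' by rewrite -deriveE.
have {1}-> : X' = \sum_i X' i 0 *: (delta_mx i 0 : 'cV[R]_n).
  rewrite {1}[X']matrix_sum_delta; apply: eq_bigr => i _.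
  by rewrite big_ord1.
rewrite linear_sum; apply: eq_bigr => i _.
by rewrite linearZ/= /gradient mxE deriveE// mulrC.
Qed.

End ChainRule.

(** * Linearity, translation and gluing for the state equation *)

Section StateEquation.
Context {R : realType} {n : nat}.
Local Notation leb := (@lebesgue_measure R).
Variables (L A N : 'M[R]_n).
Implicit Types (k : 'cV[R]_n) (C K : R -> 'cV[R]_n) (a s t : R).

Local Notation rate K C i := (fun s : R => ((L + A) *m K s - N *m C s) i 0).

Lemma rateE K C i s : ((L + A) *m K s - N *m C s) i 0 =
  \sum_j (L + A) i j * K s j 0 + \sum_j (- N i j) * C s j 0.
Proof.
rewrite !mxE -sumrN; congr (_ + _); apply: eq_bigr => j _; by rewrite mulNr.
Qed.

Lemma within_continuous_coord K i : {within `[0, +oo[, continuous K} ->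
  {within `[0, +oo[, continuous (fun s : R => K s i 0)}.
Proof.
move=> /subspace_continuousP cK; apply/subspace_continuousP => x x0.
apply: (cvg_comp _ (fun M : 'cV[R]_n => M i 0) (cK x x0)).
exact: (differentiable_continuous (differentiable_coord (K x) i 0)).
Qed.

Lemma within_continuous_colP K : {within `[0, +oo[, continuous K} <->
  forall i, {within `[0, +oo[, continuous (fun s : R => K s i 0)}.
Proof.
split=> [cK i|cK]; first exact: within_continuous_coord.
apply/subspace_continuousP => x x0; apply/cvgrPdist_le => /= e e0; near=> y.
rewrite [leLHS]/Num.Def.normr/= mx_normrE (bigmax_le _ (ltW e0))//= => -[i j] _.
rewrite (ord1 j) !mxE/=; move: i {j}; near: y.
apply: filter_forall => i.
have /subspace_continuousP/(_ x x0) := cK i.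
by move/cvgrPdist_le => /(_ e e0).
Unshelve. all: by end_near. Qed.

Lemma loc_integrable_rate C K i : L1loc_orthant C ->
  {within `[0, +oo[, continuous K} -> loc_integrable (rate K C i).
Proof.
move=> [_ iC] cK; apply: (@loc_integrable_eq _ (fun s =>
  \sum_j (L + A) i j * K s j 0 + \sum_j (- N i j) * C s j 0)).
  by move=> s _; rewrite -rateE.
apply: loc_integrableD; apply: loc_integrable_sum => j; apply: loc_integrableZ.
  exact/within_continuous_loc_integrable/within_continuous_coord.
by move=> T T0; exact: iC.
Qed.

Lemma L1loc_orthant_cone C C' s : 0 <= s -> L1loc_orthant C -> L1loc_orthant C' ->
  L1loc_orthant (fun t => C t + s *: C' t).
Proof.
move=> s0 [C0 iC] [C'0 iC']; split=> [t t0 i|i].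
  by rewrite !mxE addr_ge0 ?C0// mulr_ge0// C'0.
have := @loc_integrableD _ _ (fun t => s * C' t i 0) (iC i) (loc_integrableZ s (iC' i)).
by apply: loc_integrable_eq => t _; rewrite !mxE.
Qed.

Lemma L1loc_orthant_shift C a : 0 <= a -> L1loc_orthant C ->
  L1loc_orthant (fun t => C (t + a)).
Proof.
move=> a0 [C0 iC]; split=> [t t0 i|i]; first by rewrite C0// addr_ge0.
exact: (loc_integrable_shift a0 (iC i)).
Qed.

Lemma L1loc_orthant_concat C C' a : 0 <= a -> L1loc_orthant C -> L1loc_orthant C' ->
  L1loc_orthant (concat a C C').
Proof.
move=> a0 [C0 iC] [C'0 iC']; split=> [t t0 i|i].
  rewrite /concat; case: ltP => ta; first exact: C0.
  by apply: C'0; rewrite subr_ge0.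
have := loc_integrable_concat a0 (iC i) (iC' i).
by apply: loc_integrable_eq => t _; rewrite /concat; case: ifP.
Qed.

(** The equation is linear and the sign of [s] is free: [s = -1] gives the difference of two
    solutions, [s >= 0] the perturbed controls. *)
Lemma state_solution_cone k C K k' C' K' s :
  L1loc_orthant C -> L1loc_orthant C' ->
  state_solution L A N k C K -> state_solution L A N k' C' K' ->
  state_solution L A N (k + s *: k') (fun t => C t + s *: C' t)
    (fun t => K t + s *: K' t).
Proof.
move=> iC iC' [cK KE] [cK' KE']; split.
  move=> x; apply: cvgD; first exact: cK.
  by apply: cvgZr; exact: cK'.
move=> t i t0.
have -> : \int[leb]_(x in `[0, t]) rate (fun t => K t + s *: K' t) (fun t => C t + s *: C' t) i x =
  \int[leb]_(x in `[0, t]) (rate K C i x + s * rate K' C' i x).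
  apply: eq_Rintegral => x _; rewrite !mulmxDr -!scalemxAr.
  by rewrite !mxE; ring.
have iR := loc_integrable_rate i iC cK.
have iR' := loc_integrable_rate i iC' cK'.
rewrite RintegralD//; [|exact: iR|exact: (loc_integrableZ s iR')].
rewrite RintegralZl//; last exact: iR'.
by rewrite [LHS]mxE [(s *: K' t) i 0]mxE KE// KE'// !mxE; ring.
Qed.

Lemma state_solution0 k C K : state_solution L A N k C K -> K 0 = k.
Proof.
by move=> [_ KE]; apply/colP => i; rewrite KE// set_itv1 Rintegral_set1 addr0.
Qed.

Lemma state_solution_shift k C K a : 0 <= a -> L1loc_orthant C ->
  state_solution L A N k C K ->
  state_solution L A N (K a) (fun t => C (t + a)) (fun t => K (t + a)).
Proof.
move=> a0 iC [cK KE]; split.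
  apply/subspace_continuousP => x; rewrite /= in_itv/= andbT => x0.
  have xa0 : 0 <= x + a by exact: addr_ge0.
  have /subspace_continuousP/(_ (x + a)) := cK.
  rewrite /= in_itv/= andbT => /(_ xa0) c.
  apply: cvg_comp c; move=> P; rewrite /within/= => HP.
  have ca : {for x, continuous (fun y : R => y + a)}.
    by apply: cvgD; [exact: cvg_id|exact: cvg_cst].
  have Q : nbhs x (fun y : R => y + a \in `[0, +oo[ -> P (y + a)) := ca _ HP.
  suff: within `[0, +oo[ (nbhs x) ((fun y : R => y + a) @^-1` P) by [].
  rewrite /within/=; apply: filterS Q => y Py.
  by rewrite in_itv/= andbT => y0; apply: Py; rewrite in_itv/= andbT addr_ge0.
move=> t i t0.
rewrite (KE (t + a) i (addr_ge0 t0 a0)) (KE a i a0) -addrA [t + a]addrC.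
by congr (_ + _); exact: (Rintegral_split_shift a0 t0 (loc_integrable_rate i iC cK)).
Qed.

Lemma state_solution_concat k C K C' K' a : 0 <= a ->
  L1loc_orthant C -> L1loc_orthant C' ->
  state_solution L A N k C K -> state_solution L A N (K a) C' K' ->
  state_solution L A N k (concat a C C') (concat a K K').
Proof.
move=> a0 iC iC' SK SK'; have K'0 := state_solution0 SK'.
move: SK SK' => [cK KE] [cK' KE']; split.
  have -> : `[0, +oo[%classic = `[0, a]%classic `|` `[a, +oo[%classic :> set R.
    apply/seteqP; split=> x; rewrite /= !in_itv/= !andbT.
      by move=> x0; case: (leP x a) => xa; [left; apply/andP|right; exact: ltW].
    by move=> [/andP[]//|]; exact: le_trans.
  apply: withinU_continuous; [exact: interval_closed|exact: interval_closed| |].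
    (* At [a] itself [concat] already takes the second branch; its value there is [K' 0 = K a], so
       it agrees with [K] on the closed interval. *)
    apply: (@subspace_eq_continuous _ _ _ K).
      move=> x; rewrite inE/= in_itv/= => /andP[x0 xa].
      rewrite -[RHS]/(concat a K K' (x : R)) /concat; case: (ltP (x : R) a) => // ax.
      have -> : x = a by apply/eqP; rewrite eq_le xa.
      by rewrite subrr K'0.
    by apply: continuous_subspaceW cK => x; rewrite /= !in_itv/= => /andP[->].
  apply: (@subspace_eq_continuous _ _ _ (fun x => K' (x - a))).
    move=> x; rewrite inE/= in_itv/= andbT => ax.
    by rewrite -[RHS]/(concat a K K' (x : R)) /concat (ltNge (x : R)) ax.
  apply/subspace_continuousP => x; rewrite /= in_itv/= andbT => xa.
  have /subspace_continuousP/(_ (x - a)) := cK'.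
  rewrite /= in_itv/= andbT subr_ge0 => /(_ xa) c.
  apply: cvg_comp c; move=> P; rewrite /within/= => HP.
  have ca : {for x, continuous (fun y : R => y - a)}.
    by apply: cvgD; [exact: cvg_id|exact: cvg_cst].
  have Q : nbhs x (fun y : R => y - a \in `[0, +oo[ -> P (y - a)) := ca _ HP.
  suff: within `[a, +oo[ (nbhs x) ((fun y : R => y - a) @^-1` P) by [].
  rewrite /within/=; apply: filterS Q => y Py.
  by rewrite in_itv/= andbT => y0; apply: Py; rewrite in_itv/= andbT subr_ge0.
move=> t i t0.
have -> : \int[leb]_(x in `[0, t]) rate (concat a K K') (concat a C C') i x =
  \int[leb]_(x in `[0, t]) concat a (rate K C i) (rate K' C' i) x.
  by apply: eq_Rintegral => x _; rewrite /concat; case: ifP.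
rewrite {1}/concat; case: ltP => ta; first by rewrite KE// Rintegral_concat_lt.
rewrite KE' ?subr_ge0// KE// Rintegral_concat_ge//.
- by rewrite addrA.
- exact: (loc_integrable_rate i iC cK).
- exact: (loc_integrable_rate i iC' cK').
Qed.

Lemma state_solution_smooth C (X : R -> 'cV[R]_n) :
  (forall i, continuous (fun t => C t i 0)) ->
  (forall t i, is_derive t (1 : R) (fun s => X s i 0) (rate X C i t)) ->
  state_solution L A N (X 0) C X.
Proof.
move=> cC dX.
have cX i : continuous (fun s => X s i 0).
  by move=> t; apply/differentiable_continuous/derivable1_diffP; have [] := dX t i.
split.
  by apply/within_continuous_colP => i; apply: continuous_subspaceT; exact: cX.
have cR i : continuous (rate X C i).
  rewrite (_ : (fun s => _) = (fun s => \sum_j (L + A) i j * X s j 0 + \sum_j (- N i j) * C s j 0)); last first.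
    by apply/funext => s; rewrite rateE.
  move=> t; apply: cvgD; apply: cvg_big => [|j _]; try exact: add_continuous.
    by apply: cvgMl_tmp; exact: cX.
  by apply: cvgMl_tmp; exact: cC.
move=> t i; rewrite le_eqVlt => /predU1P[<-|t0]; first by rewrite set_itv1 Rintegral_set1 addr0.
rewrite /Rintegral (@continuous_FTC2 _ _ (fun s => X s i 0))//.
- by rewrite -EFinB/= addrC subrK.
- by apply: continuous_subspaceT; exact: cR.
- split=> [x _||]; first by have [] := dX x i.
    by apply: cvg_at_right_filter; exact: cX.
  by apply: cvg_at_left_filter; exact: cX.
- by move=> x _; rewrite derive1E; have [_ ->] := dX x i.
Qed.

End StateEquation.

Lemma is_derive_congr {R : realType} (f g : R -> R) (df dg x : R) :
  is_derive x (1 : R) f df -> f =1 g -> df = dg -> is_derive x (1 : R) g dg.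
Proof. by move=> + /funext fg <-; rewrite fg. Qed.

(** * Uniqueness of trajectories and explicit admissible controls *)

Section Trajectories.
Context {R : realType} {n : nat}.
Local Notation leb := (@lebesgue_measure R).
Variables (L A N : 'M[R]_n).
Implicit Types (k : 'cV[R]_n) (C K : R -> 'cV[R]_n) (a c s t : R) (i j : 'I_n).

(** Each product |d_i d_j| is at most half the sum of the two squares, hence at most the squared
    norm. This feeds the energy estimate for uniqueness. *)
Lemma quadratic_form_le (M : 'M[R]_n) (d : 'cV[R]_n) :
  \sum_i d i 0 * (M *m d) i 0 <= (\sum_i \sum_j `|M i j|) * \sum_i d i 0 ^+ 2.
Proof.
set q := \sum_i d i 0 ^+ 2.
have dq i : d i 0 ^+ 2 <= q.
  by rewrite /q (bigD1 i)//= lerDl sumr_ge0// => j _; rewrite sqr_ge0.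
rewrite mulr_suml; apply: ler_sum => i _; rewrite mxE mulr_sumr mulr_suml.
apply: ler_sum => j _; apply: le_trans (ler_norm _) _.
rewrite !normrM mulrCA ler_wpM2l//.
have := sqr_ge0 (`|d i 0| - `|d j 0|); rewrite sqrrB !real_normK ?num_real// => h.
have := dq i; have := dq j; lra.
Qed.

(** Energy estimate: the difference [d] solves d' = M d with d(0) = 0, and its squared norm [q],
    damped by a fast enough exponential, is nonincreasing from the value 0. *)
Lemma state_solution_unique k C K K' t : L1loc_orthant C ->
  state_solution L A N k C K -> state_solution L A N k C K' -> 0 <= t -> K t = K' t.
Proof.
move=> iC SK SK'.
have [cd dE] := state_solution_cone (-1) iC iC SK SK'.
set d := (fun t => K t + -1 *: K' t) in cd dE.
set M := L + A in dE.
(* The controls cancel, which leaves a continuous integrand; [d] is therefore differentiable at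
   every positive time and not merely almost everywhere. *)
have dE' (u : R) i : 0 <= u -> d u i 0 = \int[leb]_(s in `[0, u]) (M *m d s) i 0.
  move=> u0; rewrite dE// scaleN1r subrr [(0 : 'cV_n) i 0]mxE add0r; apply: eq_Rintegral => s _.
  have -> : C s + -1 *: C s = 0 by rewrite scaleN1r subrr.
  by rewrite mulmx0 subr0.
have cM i : {within `[0, +oo[, continuous (fun s : R => (M *m d s) i 0)}.
  rewrite (_ : (fun s => _) = (fun s => \sum_j M i j * d s j 0)); last first.
    by apply/funext => s; rewrite mxE.
  apply/subspace_continuousP => x x0; apply: cvg_big => [|j _]; first exact: add_continuous.
  apply: cvgMl_tmp.
  by have /subspace_continuousP := within_continuous_coord (i := j) cd; apply.
have dd (u : R) i : 0 < u -> is_derive u (1 : R) (fun s => d s i 0) ((M *m d u) i 0).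
  move=> u0.
  have iM := within_continuous_loc_integrable (cM i).
  have cu : {for u, continuous (fun s : R => (M *m d s) i 0)}.
    have /continuous_within_itvcyP[+ _] := cM i; apply.
    by rewrite in_itv/= u0.
  have [F1 F2] := @continuous_FTC1 _ _ (BLeft 0) u (u + 1) (ltr_pwDr ltr01 (lexx u))
    (iM _ (addr_ge0 (ltW u0) ler01)) u0 cu.
  have : is_derive u (1 : R) (fun y : R => \int[leb]_(s in `[0, y]) (M *m d s) i 0) ((M *m d u) i 0).
    by split; [exact: F1|rewrite -derive1E; exact: F2].
  apply: near_eq_is_derive.
  near=> y; rewrite dE'//; apply/ltW; near: y; exact: lt_nbhsr.
(* Twice the constant of [quadratic_form_le], because differentiating the squares produces a factor
   2. *)
pose kap := 2 * \sum_i \sum_j `|M i j|.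
pose q u := \sum_i d u i 0 ^+ 2.
pose h u := expR (- kap * u) * q u.
have dh (u : R) : 0 < u -> is_derive u (1 : R) h
    (expR (- kap * u) * (\sum_i 2 * (d u i 0 * (M *m d u) i 0)) + - kap * expR (- kap * u) * q u).
  move=> u0.
  have dq : is_derive u (1 : R) q (\sum_i 2 * (d u i 0 * (M *m d u) i 0)).
    rewrite /q (_ : (fun u => _) = \sum_i (fun u => d u i 0 ^+ 2)); last first.
      by apply/funext => y; rewrite fct_sumE.
    apply: is_derive_sum => i.
    apply: (is_derive_congr (is_deriveX 2 (dd u i u0))) => //.
    by rewrite /GRing.scale/=; ring.
  have de : is_derive u (1 : R) (fun u => expR (- kap * u)) (- kap * expR (- kap * u)).
    by apply: is_derive_eq; rewrite /GRing.scale/=; ring.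
  by apply: (is_derive_congr (is_deriveM de dq)) => //; rewrite /GRing.scale/=; ring.
rewrite le_eqVlt => /predU1P[<-|t0].
  by rewrite (state_solution0 SK) (state_solution0 SK').
have ch0 : {within `[0, +oo[, continuous h}.
  apply/subspace_continuousP => x x0; apply: cvgM.
    apply: cvg_within_filter; apply: (@continuous_comp _ _ _ (fun u => - kap * u) expR).
      by apply: cvgMl_tmp; exact: cvg_id.
    exact: continuous_expR.
  apply: cvg_big => [|j _]; first exact: add_continuous.
  have /subspace_continuousP cj := within_continuous_coord (i := j) cd.
  by apply: cvgM; exact: cj.
have ch : {within `[0, t], continuous h}.
  by apply: continuous_subspaceW ch0 => x; rewrite /= !in_itv/= => /andP[->].
have hle : h t <= h 0.
  have dh1 x : x \in `]0, t[ -> derivable h x 1.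
    by rewrite in_itv/= => /andP[x0 _]; have [] := dh x x0.
  have dh2 x : x \in `]0, t[ -> derive1 h x <= 0.
    rewrite in_itv/= => /andP[x0 _]; rewrite derive1E; have [_ ->] := dh x x0.
    have := quadratic_form_le M (d x); rewrite -mulr_sumr /kap -/(q x).
    set S := \sum_i d x i 0 * _; set E := expR _ => HS.
    have E0 : 0 < E by exact: expR_gt0.
    have := ler_pM2l E0 S ((\sum_i \sum_j `|M i j|) * q x); rewrite HS => /idP; lra.
  have in0 : 0 \in `[0, t] by rewrite in_itv/= lexx ltW.
  have int : t \in `[0, t] by rewrite in_itv/= lexx ltW.
  exact: (ler0_derive1_le_cc dh1 dh2 ch int in0 (ltW t0)).
have q0 : q 0 = 0.
  rewrite /q big1// => i _; rewrite dE'// set_itv1 Rintegral_set1 expr0n//.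
have qt : q t <= 0.
  by move: hle; rewrite /h q0 mulr0 pmulr_rle0// expR_gt0.
have qi i : d t i 0 ^+ 2 = 0.
  apply/eqP; rewrite eq_le sqr_ge0 andbT (le_trans _ qt)// /q (bigD1 i)//= lerDl.
  by rewrite sumr_ge0// => j _; rewrite sqr_ge0.
apply/colP => i; have /eqP := qi i; rewrite sqrf_eq0 /d !mxE mulN1r subr_eq0.
by move=> /eqP.
Unshelve. all: by end_near. Qed.

Lemma admissible_cone k C k' C' s : 0 <= s -> admissible L A N k C ->
  admissible L A N k' C' ->
  admissible L A N (k + s *: k') (fun t => C t + s *: C' t).
Proof.
move=> s0 [iC [K [SK K0]]] [iC' [K' [SK' K0']]]; split; first exact: L1loc_orthant_cone.
exists (fun t => K t + s *: K' t); split; first exact: state_solution_cone.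
by move=> t t0 i; rewrite !mxE addr_ge0 ?K0// mulr_ge0// K0'.
Qed.

Lemma admissible_concat k C K C' a : 0 <= a -> L1loc_orthant C ->
  state_solution L A N k C K -> (forall t, 0 <= t < a -> orthant (K t)) ->
  admissible L A N (K a) C' -> admissible L A N k (concat a C C').
Proof.
move=> a0 iC SK K0 [iC' [K' [SK' K0']]]; split; first exact: L1loc_orthant_concat.
exists (concat a K K'); split; first exact: state_solution_concat.
move=> t t0; rewrite /concat; case: ltP => ta; first by apply: K0; rewrite t0.
by apply: K0'; rewrite subr_ge0.
Qed.

Lemma admissible_shift k C K a : 0 <= a -> L1loc_orthant C ->
  state_solution L A N k C K -> (forall t, 0 <= t -> orthant (K t)) ->
  admissible L A N (K a) (fun t => C (t + a)).
Proof.
move=> a0 iC SK K0; split; first exact: L1loc_orthant_shift.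
exists (fun t => K (t + a)); split; first exact: state_solution_shift SK.
by move=> t t0; apply: K0; exact: addr_ge0.
Qed.

(** Variation of constants for the constant control [c]. *)
Definition constant_path k (c : 'cV[R]_n) t : 'cV[R]_n :=
  flow (L + A) k t - flow_int (L + A) (N *m c) t.

Lemma constant_path_is_derive k (c : 'cV[R]_n) t i :
  is_derive t (1 : R) (fun s => constant_path k c s i 0)
    (((L + A) *m constant_path k c t - N *m c) i 0).
Proof.
apply: (is_derive_congr
  (is_deriveB (is_derive_flow (L + A) k i t) (is_derive_flow_int (L + A) (N *m c) i t))).
  by move=> s; rewrite [RHS]mxE; congr (_ + _); rewrite [RHS]mxE.
rewrite mulmxBr mulmx_flow mulmx_flow_int.
set F := flow _ _ _; set G := flow _ _ _; set D := N *m c.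
by rewrite !mxE; ring.
Qed.

Lemma constant_path0 k (c : 'cV[R]_n) : constant_path k c 0 = k.
Proof. by rewrite /constant_path flow0 flow_int0 subr0. Qed.

Lemma constant_path_solution k (c : 'cV[R]_n) :
  state_solution L A N k (fun=> c) (constant_path k c).
Proof.
rewrite -{1}(constant_path0 k c); apply: state_solution_smooth.
  by move=> i; exact: cst_continuous.
by move=> t i; exact: constant_path_is_derive.
Qed.

Hypothesis metzler : forall i j, i != j -> 0 <= (L + A) i j.

Lemma metzler_shift : exists c, forall i j, 0 <= (L + A + c%:M) i j.
Proof.
exists (\sum_i `|(L + A) i i|) => i j; rewrite mxE [(_%:M) _ _]mxE.
have [<-|ij] := eqVneq i j; last by rewrite addr0 metzler.
rewrite mulr1n (bigD1 i)//= addrA addr_ge0 ?sumr_ge0//.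
by have := ler_norm (- (L + A) i i); rewrite normrN; lra.
Qed.

Lemma is_derive_expRM c t :
  is_derive t (1 : R) (fun s : R => expR (- c * s)) (- c * expR (- c * t)).
Proof. by apply: is_derive_eq; rewrite /GRing.scale/=; ring. Qed.

Lemma zero_control_L1loc : L1loc_orthant (fun=> 0 : 'cV[R]_n).
Proof.
split=> [t _ i|i T T0]; first by rewrite mxE.
rewrite (_ : (fun t => _) = cst 0%E); first exact: integrable0.
by apply/funext => t; rewrite mxE.
Qed.

(** The uncontrolled trajectory is written as e^(-ct) e^(tP) k with P nonnegative, a form in which
    it visibly stays in the orthant. *)
Lemma admissible_zero k : orthant k -> admissible L A N k (fun=> 0).
Proof.
move=> k0; split; first exact: zero_control_L1loc.
have [c Pc] := metzler_shift; set P := L + A + c%:M in Pc.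
pose X t := expR (- c * t) *: flow P k t.
exists X; split; last first.
  move=> t t0 i; rewrite mxE mulr_ge0 ?expR_ge0//.
  by have := flow_ge0 Pc k0 t0; apply.
have -> : k = X 0 by rewrite /X mulr0 expR0 scale1r flow0.
apply: state_solution_smooth => [i|t i].
  by rewrite (_ : (fun t => _) = cst 0); [exact: cst_continuous|apply/funext => t; rewrite mxE].
apply: (is_derive_congr (is_deriveM (is_derive_expRM c t) (is_derive_flow P k i t))).
  by move=> s; rewrite [RHS]mxE.
rewrite mulmx0 subr0 -mulmx_flow.
have -> : L + A = P - c%:M by rewrite /P addrK.
rewrite mulmxBl mul_scalar_mx /X -scalemxAr.
set F := flow _ _ _; set PF := P *m F.
by rewrite !mxE /GRing.scale/=; ring.
Qed.

(** The capital N e_i finances the consumption e^(-ct) e_i on [0, 1[. With y = N e_i, the state is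
    e^(-ct) times e^(tP) y minus the integral of e^(sP) y over [0, t], which is nonnegative up to
    time 1. *)
Lemma admissible_impulse i : preserves_orthant N -> exists g : R -> R,
  [/\ forall t, 0 <= g t, forall t, 0 <= t -> t < 1 -> 0 < g t &
      admissible L A N (N *m delta_mx i 0) (fun t => g t *: delta_mx i 0)].
Proof.
move=> hN; have [c Pc] := metzler_shift; set P := L + A + c%:M in Pc.
have d0 : orthant (delta_mx i 0 : 'cV[R]_n) by move=> l; rewrite mxE ler0n.
pose y : 'cV[R]_n := N *m delta_mx i 0; have y0 : orthant y by exact: hN.
pose e t := expR (- c * t).
have ce : continuous e.
  by move=> t; apply/differentiable_continuous/derivable1_diffP; have [] := is_derive_expRM c t.
pose X t := e t *: (flow P y t - flow_int P y t).
pose C t : 'cV[R]_n := e t *: delta_mx i 0.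
have iC : L1loc_orthant C.
  split=> [t t0 l|l]; first by rewrite mxE mulr_ge0 ?expR_ge0.
  apply: within_continuous_loc_integrable; apply: continuous_subspaceT => t.
  rewrite (_ : (fun s => _) = (fun s => e s * (delta_mx i 0 : 'cV[R]_n) l 0)).
    by apply: cvgMr_tmp; exact: ce.
  by apply/funext => s; rewrite mxE.
have X00 : X 0 = y by rewrite /X /e mulr0 expR0 scale1r flow0 flow_int0 subr0.
have SX : state_solution L A N y C X.
  rewrite -X00; apply: state_solution_smooth => [l t|t l].
    rewrite (_ : (fun s => _) = (fun s => e s * (delta_mx i 0 : 'cV[R]_n) l 0)).
      by apply: cvgMr_tmp; exact: ce.
    by apply/funext => s; rewrite mxE.
  apply: (is_derive_congr (is_deriveM (is_derive_expRM c t)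
    (is_deriveB (is_derive_flow P y l t) (is_derive_flow_int P y l t)))).
    move=> s; rewrite [RHS]mxE; congr (_ * _); rewrite [RHS]mxE; congr (_ + _).
    by rewrite [RHS]mxE.
  have -> : L + A = P - c%:M by rewrite /P addrK.
  rewrite mulmxBl mul_scalar_mx /X /C -!scalemxAr -/y mulmxBr mulmx_flow_int mulmx_flow.
  rewrite /e. set F := flow P y t; set PF := flow P (P *m y) t; set G := flow_int _ _ _.
  by rewrite !mxE /GRing.scale/= !fctE/= !mxE; ring.
have X1 t : 0 <= t -> t <= 1 -> orthant (X t).
  move=> t0 t1 l.
  have -> : X t l 0 = e t * (flow P y t l 0 - flow_int P y t l 0).
    by rewrite [LHS]mxE; congr (_ * _); rewrite [LHS]mxE; congr (_ + _); rewrite [LHS]mxE.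
  by rewrite mulr_ge0 ?expR_ge0// subr_ge0 flow_int_le_flow.
(* Nonnegativity of [X] is established only up to time 1, so consumption stops there; the state is
   then in the orthant and the zero control is admissible from it. *)
exists (concat 1 e (fun=> 0)); split.
- by move=> t; rewrite /concat; case: ifP => // _; exact: expR_ge0.
- by move=> t t0 t1; rewrite /concat t1 expR_gt0.
- rewrite (_ : (fun t => _) = concat 1 C (fun=> 0)); last first.
    by apply/funext => t; rewrite /concat /C; case: ifP => // _; rewrite scale0r.
  apply: (admissible_concat ler01 iC SX).
    by move=> t /andP[t0 t1]; apply: X1 => //; exact: ltW.
  by apply: admissible_zero; exact: X1.
Qed.

End Trajectories.

(** * Payoffs and dynamic programming *)

Section AlmostEverywhere.
Context {R : realType}.
Local Notation leb := (@lebesgue_measure R).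

(** A null set cannot contain an interval of positive length. *)
Lemma ae_itv_exists (P : R -> Prop) (a b : R) : a < b ->
  {ae leb, forall t, P t} -> exists t, [/\ a <= t, t < b & P t].
Proof.
move=> ab [A [mA A0 PA]]; apply: contrapT => nP.
have : (leb `[a, b[%classic <= leb A)%E.
  apply: le_measure; rewrite ?inE// => t; rewrite /= in_itv/= => /andP[at_ tb].
  by apply: PA => /= Pt; apply: nP; exists t.
by rewrite A0 lebesgue_measure_itv/= lte_fin ab -EFinB lee_fin leNgt subr_gt0 ab.
Qed.

Lemma ae_imp (P Q : R -> Prop) : (forall t, P t -> Q t) ->
  {ae leb, forall t, P t} -> {ae leb, forall t, Q t}.
Proof. by have F := ae_filter_ringOfSetsType leb; exact: filterS. Qed.

Lemma ae_and (P Q : R -> Prop) : {ae leb, forall t, P t} ->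
  {ae leb, forall t, Q t} -> {ae leb, forall t, P t /\ Q t}.
Proof. by have F := ae_filter_ringOfSetsType leb; exact: filterI. Qed.

Lemma ae_forall_ord (m : nat) (P : 'I_m -> R -> Prop) :
  (forall i, {ae leb, forall t, P i t}) -> {ae leb, forall t, forall i, P i t}.
Proof. by have F := ae_filter_ringOfSetsType leb; exact: filter_forall. Qed.

End AlmostEverywhere.

Section Payoff.
Context {R : realType} {n : nat}.
Local Notation leb := (@lebesgue_measure R).
Variables (rho gamma : R) (p : 'I_n -> R).
Hypotheses (hrho : 0 < rho) (hgamma : 0 < gamma) (hp : forall i, 0 < p i).
Implicit Types (C : R -> 'cV[R]_n) (c : 'cV[R]_n) (a s t : R) (i j : 'I_n).

Definition gain C t : \bar R :=
  ((expR (- rho * t)%R)%:E * total_utility gamma p (C t))%E.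

(** No single utility is [+oo], so the sum is [-oo] as soon as one summand is, and an ordinary real
    sum otherwise. *)
Lemma total_utility_cases c : orthant c ->
  total_utility gamma p c = -oo%E \/
  exists2 r : 'I_n -> R, (forall i, utility gamma (c i 0) = (r i)%:E) &
    total_utility gamma p c = (\sum_i p i * r i)%:E.
Proof.
move=> c0; have [H|/existsNP[i /negP/negPn/eqP Hi]] := pselect (forall i, utility gamma (c i 0) != -oo%E).
  right; exists (fun i => fine (utility gamma (c i 0))).
    by move=> i; have := H i; case: (utility_ge0_cases gamma (c0 i)) => [->|[r ->]]; rewrite ?eqxx.
  rewrite /total_utility -sumEFin; apply: eq_bigr => i _.
  by have := H i; case: (utility_ge0_cases gamma (c0 i)) => [->|[r ->]]; rewrite ?eqxx.
left; rewrite /total_utility (bigD1 i)//= Hi gt0_muleNy ?lte_fin//.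
Qed.

Lemma total_utility_gt0 c : pos_orthant c ->
  total_utility gamma p c = (\sum_i p i * rutility gamma (c i 0))%:E.
Proof.
move=> c0; rewrite /total_utility -sumEFin; apply: eq_bigr => i _.
by rewrite utility_gt0.
Qed.

Lemma total_utility_incr c c' i : orthant c -> (forall j, c j 0 <= c' j 0) ->
  c i 0 < c' i 0 -> total_utility gamma p c != -oo%E ->
  (total_utility gamma p c < total_utility gamma p c')%E.
Proof.
move=> c0 cc' ci; have c'0 : orthant c' by move=> j; exact: le_trans (cc' j).
case: (total_utility_cases c0) => [->//|[r rE ->] _].
have ur j : (utility gamma (c j 0%R) <= utility gamma (c' j 0%R))%E.
  by have := cc' j; rewrite le_eqVlt => /predU1P[->//|cj]; exact/ltW/utility_incr.
case: (total_utility_cases c'0) => [|[r' r'E ->]].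
  move=> H; have [j Hj] : exists j, utility gamma (c' j 0) = -oo%E.
    apply: contrapT => nj; move: H; rewrite /total_utility => /esum_eqNyP.
    move=> [j [_ _]]; case: (utility_ge0_cases gamma (c'0 j)) => [uj|[r' ->]]//.
    by move=> _; apply: nj; exists j.
  by have := ur j; rewrite Hj rE.
rewrite lte_fin (bigD1 i)//= [ltRHS](bigD1 i)//= ltr_leD//.
  by rewrite ltr_pM2l// -lte_fin -rE -r'E utility_incr.
apply: ler_sum => j _; rewrite ler_pM2l//.
by have := ur j; rewrite rE r'E lee_fin.
Qed.

Lemma total_utility_concave c c' s : orthant c -> (forall j, c j 0 <= c' j 0) ->
  0 < s -> s < 1 ->
  ((1 - s)%:E * total_utility gamma p c + s%:E * total_utility gamma p c'
    <= total_utility gamma p (c + s *: (c' - c)))%E.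
Proof.
move=> c0 cc' s0 s1; have c'0 : orthant c' by move=> j; exact: le_trans (cc' j).
have c''0 : orthant (c + s *: (c' - c)).
  by move=> j; rewrite !mxE addr_ge0// mulr_ge0 ?(ltW s0)// subr_ge0.
have s1' : 0 < 1 - s by rewrite subr_gt0.
case: (total_utility_cases c0) => [->|[r rE ->]].
  by rewrite gt0_muleNy ?lte_fin// addNye leNye.
case: (total_utility_cases c'0) => [->|[r' r'E ->]].
  by rewrite [(s%:E * _)%E]gt0_muleNy ?lte_fin// addeNy leNye.
rewrite -!EFinM -EFinD !mulr_sumr -big_split/= -sumEFin; apply: lee_sum => i _.
have := utility_concave hgamma (c0 i) (cc' i) s0 s1.
rewrite rE r'E -!EFinM -EFinD => h.
have -> : (1 - s) * (p i * r i) + s * (p i * r' i) = p i * ((1 - s) * r i + s * r' i) by ring.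
by rewrite EFinM lee_pmul2l ?lte_fin//; apply: le_trans h _; rewrite !mxE.
Qed.

Lemma total_utility_le c : orthant c ->
  (total_utility gamma p c <= (\sum_i p i * (`|rutility gamma 1| + c i 0))%:E)%E.
Proof.
move=> c0; rewrite /total_utility -sumEFin; apply: lee_sum => i _.
rewrite EFinM lee_pmul2l ?lte_fin//.
apply: le_trans (utility_le_linear hgamma (c0 i)) _.
by rewrite lee_fin lerD2r ler_norm.
Qed.

Lemma gain_incr C C' t i : orthant (C t) -> (forall j, C t j 0 <= C' t j 0) ->
  C t i 0 < C' t i 0 -> gain C t \is a fin_num -> (gain C t < gain C' t)%E.
Proof.
move=> C0 CC' Ci; rewrite /gain; have := @expR_gt0 _ (- rho * t); set e := expR _ => e0 fG.
rewrite lte_pmul2l ?lte_fin//; apply: (total_utility_incr C0 CC' Ci).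
by apply/eqP => UE; move: fG; rewrite UE gt0_muleNy ?lte_fin.
Qed.

Lemma measurable_coord C i : L1loc_orthant C -> measurable_fun (`[0, +oo[ : set R) (fun t => C t i 0).
Proof.
move=> [_ iC]; rewrite itv_bndy_bigcup_BRight.
apply/measurable_fun_bigcup => // m.
have := iC i m%:R (ler0n _ _); rewrite add0r => /integrableP[+ _].
by move/measurable_EFinP.
Qed.

Lemma measurable_gain C : L1loc_orthant C -> measurable_fun (`[0, +oo[ : set R) (gain C).
Proof.
move=> iC; apply: emeasurable_funM.
  apply: measurable_funTS; apply/measurable_EFinP.
  by apply: measurableT_comp => //; exact: measurable_funM.
apply: emeasurable_sum => i; apply: measurable_funeM.
apply: (measurable_comp measurableT) => //; first exact: measurable_utility.
exact: measurable_coord.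
Qed.

(** Discounting is multiplicative in time, so the tail is a rescaled payoff of the shifted control.
    Measurability is enough, and payoffs equal to [-oo] are included. *)
Lemma payoff_split C a : L1loc_orthant C -> 0 <= a ->
  payoff rho gamma p C = (\int[leb]_(t in `[0%R, a[) gain C t +
    (expR (- rho * a))%:E * payoff rho gamma p (fun t => C (t + a)%R))%E.
Proof.
move=> iC a0; have mG := measurable_gain iC.
have U : `[0, +oo[%classic = `[0, a[%classic `|` `[a, +oo[%classic :> set R.
  by rewrite -itv_bndbnd_setU// ?bnd_simp.
rewrite /payoff -/(gain C) {1}U measurable_integral_setU//; last 2 first.
- by rewrite -U.
- apply/disj_setPLR => t; rewrite /= !in_itv/= => /andP[_ ta].
  by rewrite leNgt ta.
congr (_ + _)%E.
have pre : (fun x : R => x + a) @^-1` `[a, +oo[%classic = `[0, +oo[%classic.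
  by apply/seteqP; split=> t; rewrite /= !in_itv/= !andbT lerDr.
rewrite [LHS](@integral_shift _ a)//; last first.
  have sub : (`[a, +oo[ : set R) `<=` `[0, +oo[.
    by move=> t; rewrite /= !in_itv/= !andbT => /(le_trans a0).
  by apply: measurable_funS sub mG.
rewrite pre -measurable_integralZl ?expR_gt0//.
  apply: eq_integral => t _; rewrite /gain muleA -EFinM -expRD; congr ((expR _)%:E * _)%E.
  by ring.
exact: (measurable_gain (L1loc_orthant_shift a0 iC)).
Qed.

Lemma eq_payoff C C' : (forall t, 0 <= t -> C t = C' t) ->
  payoff rho gamma p C = payoff rho gamma p C'.
Proof.
move=> CC'; apply: eq_integral => t; rewrite inE/= in_itv/= andbT => t0.
by rewrite CC'.
Qed.

Lemma payoff_concat C C' a : L1loc_orthant C -> L1loc_orthant C' -> 0 <= a ->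
  payoff rho gamma p (concat a C C') = (\int[leb]_(t in `[0%R, a[) gain C t +
    (expR (- rho * a))%:E * payoff rho gamma p C')%E.
Proof.
move=> iC iC' a0; rewrite (payoff_split (L1loc_orthant_concat a0 iC iC') a0).
rewrite (@eq_payoff _ C') => [|t t0]; last by rewrite /concat ltNge lerDr t0/= addrK.
rewrite (@eq_integral _ _ _ leb _ (gain C))// => t; rewrite inE/= in_itv/= => /andP[_ ta].
by rewrite /gain /concat ta.
Qed.

(** Utility grows at most linearly and the control is locally integrable. Over a bounded time the
    gain is thus finite or [-oo]. *)
Lemma integral_gain_lty C a : L1loc_orthant C -> 0 <= a ->
  (\int[leb]_(t in `[0%R, a[) gain C t < +oo)%E.
Proof.
move=> iC a0.
pose B t := \sum_i p i * (`|rutility gamma 1| + C t i 0).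
have iB : loc_integrable B.
  apply: loc_integrable_sum => i; apply: loc_integrableZ; apply: loc_integrableD; last exact: iC.2.
  by apply: within_continuous_loc_integrable; apply: continuous_subspaceT; exact: cst_continuous.
have sub : (`[0, a[ : set R) `<=` `[0, a] by move=> s; rewrite /= !in_itv/= => /andP[-> /ltW].
have sub' : (`[0, a[ : set R) `<=` `[0, +oo[ by move=> s; rewrite /= !in_itv/= => /andP[->].
have iBa : leb.-integrable `[0, a[ (EFin \o B) by apply: integrableS (iB a a0).
apply: (@le_lt_trans _ _ (\int[leb]_(t in `[0%R, a[) (B t)%:E)%E); last first.
  exact: integrable_lty.
apply: measurable_le_integral => //.
- by apply: measurable_funS sub' (measurable_gain iC).
- exact: (measurable_int leb iBa).
move=> t; rewrite /= in_itv/= => /andP[t0 _].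
have C0 := iC.1 t t0.
have B0 : 0 <= B t.
  by apply: sumr_ge0 => i _; rewrite mulr_ge0 ?(ltW (hp i))// addr_ge0.
apply: (@le_trans _ _ ((expR (- rho * t))%:E * (B t)%:E)%E).
  by rewrite lee_pmul2l ?lte_fin ?expR_gt0// total_utility_le.
rewrite -EFinM lee_fin ler_piMl// -expR0 ler_expR mulNr oppr_le0.
by rewrite mulr_ge0// ltW.
Qed.

End Payoff.

Section DirectionalDerivative.
Context {R : realType} {n : nat}.
Implicit Types (x y : 'cV[R]_n) (s r : R).

Lemma is_derive_affine x (y : 'cV[R]_n) s j :
  is_derive s (1 : R) (fun s => (x + s *: y) j 0) (y j 0).
Proof.
apply: (is_derive_congr (f := fun s => x j 0 + s * y j 0) (df := y j 0)) => // [|t].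
  by apply: is_derive_eq; rewrite /GRing.scale/=; ring.
by rewrite !mxE.
Qed.

(** Subtracting from [w] its linear lower bound along the ray leaves a function of [s] that to the
    right of 0 is at least its value at 0. In the application [r] is the payoff of the fully
    perturbed control. *)
Lemma directional_derivative_ge (w : 'cV[R]_n -> R) x y r : differentiable w x ->
  (forall s, 0 < s -> s < 1 -> (1 - s) * w x + s * r <= w (x + s *: y)) ->
  r - w x <= \sum_j gradient w x j 0 * y j 0.
Proof.
move=> dw key; pose f s := w (x + s *: y) - s * (r - w x).
have x0E : x + 0 *: y = x by rewrite scale0r addr0.
have df : is_derive (0 : R) (1 : R) f (\sum_j gradient w x j 0 * y j 0 - (r - w x)).
  have dw0 : differentiable w (x + 0 *: y) by rewrite x0E.
  have d1 := is_derive_gradient dw0 (is_derive_affine x y 0).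
  have d2 : is_derive (0 : R) (1 : R) (fun s : R => s * (r - w x)) (r - w x).
    by apply: is_derive_eq; rewrite /GRing.scale/=; ring.
  by apply: (is_derive_congr (is_deriveB d1 d2)) => //; rewrite x0E.
rewrite -subr_ge0; apply: (is_derive_right_ge0 df); near=> h.
have h0 : 0 < h by near: h; exact: nbhs_right_gt.
have h1 : h < 1 by near: h; exact: nbhs_right_lt.
by have := key h h0 h1; rewrite /f addr0 x0E mul0r subr0; lra.
Unshelve. all: by end_near. Qed.

End DirectionalDerivative.

Lemma lee_addMl_cancel {R : realType} (I x y : \bar R) (e : R) : I \is a fin_num ->
  0 < e -> (I + e%:E * x <= I + e%:E * y)%E -> (x <= y)%E.
Proof. by move=> fI e0; rewrite leeD2lE// lee_pmul2l ?lte_fin. Qed.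

(** * Dynamic programming and the marginal value of consumption *)

Section DynamicProgramming.
Context {R : realType} {n : nat}.
Local Notation leb := (@lebesgue_measure R).
Variables (L A N : 'M[R]_n) (rho gamma : R) (p : 'I_n -> R).
Hypotheses (hrho : 0 < rho) (hgamma : 0 < gamma) (hp : forall i, 0 < p i).
Hypothesis metzler : forall i j, i != j -> 0 <= (L + A) i j.
Hypothesis hN : preserves_orthant N.
Implicit Types (x k c : 'cV[R]_n) (C K : R -> 'cV[R]_n) (a s t h : R) (i j : 'I_n).

Local Notation V := (value L A N rho gamma p).
Local Notation v := (fine_value L A N rho gamma p).
Local Notation J := (payoff rho gamma p).
Local Notation G := (gain rho gamma p).
Local Notation adm := (admissible L A N).

Lemma payoff_le_value k C : adm k C -> (J C <= V k)%E.
Proof. by move=> aC; apply: ereal_sup_ubound; exists C. Qed.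

Lemma value_ge_concat k C K a : 0 <= a -> L1loc_orthant C ->
  state_solution L A N k C K -> (forall t, 0 <= t < a -> orthant (K t)) ->
  V (K a) \is a fin_num -> V k \is a fin_num ->
  (\int[leb]_(t in `[0%R, a[) G C t)%E \is a fin_num ->
  fine (\int[leb]_(t in `[0%R, a[) G C t)%E + expR (- rho * a) * v (K a) <= v k.
Proof.
move=> a0 iC SK K0 fa fk fI; set I := (\int[leb]_(t in _) _)%E in fI *.
set e := expR (- rho * a); have e0 : 0 < e by exact: expR_gt0.
(* The bound is uniform over the continuations from [K a], so it passes to the supremum directly and
   no almost optimal control has to be chosen. *)
have ub : (V (K a) <= ((v k - fine I) / e)%:E)%E.
  apply: ge_ereal_sup => _ [C' aC' <-].
  have := payoff_le_value (admissible_concat a0 iC SK K0 aC').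
  rewrite payoff_concat//; last exact: aC'.1.
  rewrite -/I -/e -(fineK fI) -(fineK fk).
  case: (J C') => [r| |_]; last exact: leNye.
    by rewrite -EFinM -EFinD !lee_fin ler_pdivlMr// => h; rewrite mulrC lerBrDl.
  by rewrite gt0_muley ?lte_fin// addey// leye_eq.
have : fine (V (K a)) <= (v k - fine I) / e by rewrite -lee_fin fineK.
by rewrite ler_pdivlMr// mulrC lerBrDl.
Qed.

Lemma pos_orthant_sub x (y : 'cV[R]_n) : pos_orthant x -> exists2 e : R, 0 < e & orthant (x - e *: y).
Proof.
move=> x0; suff [e [e0 xe]] : exists e : R, 0 < e /\ orthant (x - e *: y) by exists e.
have H : \forall e \near (0 : R)^'+, forall i, 0 <= x i 0 - e * y i 0.
  apply: filter_forall => i; have [y0|y0] := leP (y i 0) 0.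
    near=> e; by rewrite subr_ge0 (le_trans _ (ltW (x0 i)))// mulr_ge0_le0.
  have xy0 : 0 < x i 0 / y i 0 by apply: divr_gt0 => //; exact: x0.
  by near=> e; rewrite subr_ge0 -ler_pdivlMr//; near: e; exact: nbhs_right_ltW.
near (0 : R)^'+ => e; exists e; split=> // i.
rewrite !mxE; move: i; near: e; exact: H.
Unshelve. all: by end_near. Qed.

(** An interior point can spare a small multiple of N e_i: the zero control competes with a scaled
    copy of the control of [admissible_impulse]. The two differ on an interval, which uniqueness of
    the optimum will exclude. *)
Lemma admissible_distinct x i : pos_orthant x -> exists C1 C2,
  [/\ adm x C1, adm x C2 & forall t, 0 <= t -> t < 1 -> C1 t != C2 t].
Proof.
move=> x0; have [g [g0 g1 ag]] := admissible_impulse metzler i hN.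
have [e e0 xe] := pos_orthant_sub (N *m delta_mx i 0) x0.
exists (fun=> 0), (fun t => 0 + e *: (g t *: delta_mx i 0)); split.
- by apply: admissible_zero => // j; exact: ltW.
- rewrite -[x](subrK (e *: (N *m delta_mx i 0))).
  by apply: admissible_cone => //; [exact: ltW|exact: admissible_zero].
- move=> t t0 t1; apply/eqP => /colP/(_ i); rewrite !mxE !eqxx/= mulr1 add0r => /esym/eqP.
  by rewrite gt_eqF// mulr_gt0// g1.
Qed.

(** Were the gain [I] on [0, a[ equal to [-oo], the value at [k] would be [-oo] and [C] followed by
    any admissible control from [K a] would be optimal, against uniqueness by [admissible_distinct].
    Hence [I] is finite and can be cancelled when comparing [C] with its modifications after [a]. *)
Lemma optimal_tail k C K a i : is_the_optimal L A N rho gamma p k C ->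
  state_solution L A N k C K -> (forall t, 0 <= t -> orthant (K t)) ->
  0 <= a -> pos_orthant (K a) -> V (K a) \is a fin_num ->
  J C \is a fin_num /\ J (fun t => C (t + a)) = V (K a).
Proof.
move=> [[[iC aC] JC] uC] SK K0 a0 Ka fa.
set I := (\int[leb]_(t in `[0%R, a[) G C t)%E.
set e := expR (- rho * a); have e0 : 0 < e by exact: expR_gt0.
have Ilty : (I < +oo)%E by exact: integral_gain_lty.
have K0a t : 0 <= t < a -> orthant (K t) by move=> /andP[t0 _]; exact: K0.
have Jsplit : J C = (I + e%:E * J (fun t => C (t + a)%R))%E by exact: payoff_split.
have aCa := admissible_shift a0 iC SK K0.
have InNy : I != -oo%E.
  apply/eqP => INy.
  have VNy : V k = -oo%E by rewrite -JC Jsplit INy addNye.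
  have opt C1 : adm (K a) C1 -> ae_equal (concat a C C1) C.
    move=> aC1; apply: uC; split; first exact: (admissible_concat a0 iC SK K0a aC1).
    by rewrite VNy (payoff_concat _ _ _ iC aC1.1 a0) -/I INy addNye.
  have [C1 [C2 [aC1 aC2 C12]]] := admissible_distinct i Ka.
  have ae12 : {ae leb, forall t, 0 <= t -> concat a C C1 t = concat a C C2 t}.
    apply: ae_imp (ae_and (opt C1 aC1) (opt C2 aC2)) => t [h1 h2] t0.
    by rewrite h1// h2.
  have [t [at_ ta]] := ae_itv_exists (ltr_pwDr ltr01 (lexx a)) ae12.
  move/(_ (le_trans a0 at_)); rewrite /concat ltNge at_/=.
  by apply/eqP; apply: C12; rewrite ?subr_ge0// ltrBlDl.
have fI : I \is a fin_num by rewrite fin_numE InNy/= lt_eqF.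
have JV : J (fun t => C (t + a)) = V (K a).
  apply/eqP; rewrite eq_le payoff_le_value//=.
  apply: ge_ereal_sup => _ [C1 aC1 <-].
  have := payoff_le_value (admissible_concat a0 iC SK K0a aC1).
  rewrite -JC Jsplit (payoff_concat _ _ _ iC aC1.1 a0).
  exact: (lee_addMl_cancel fI e0).
by split; [rewrite Jsplit JV fin_numD fI/= fin_numM|exact: JV].
Qed.

Lemma gain_concave C C' s t : orthant (C t) -> (forall j, C t j 0 <= C' t j 0) ->
  0 < s -> s < 1 ->
  ((1 - s)%:E * G C t + s%:E * G C' t <= G (fun t => C t + s *: (C' t - C t))%R t)%E.
Proof.
move=> C0 CC' s0 s1; have C'0 : orthant (C' t) by move=> j; exact: le_trans (CC' j).
have s1' : 0 < 1 - s by rewrite subr_gt0.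
have := total_utility_concave hgamma hp C0 CC' s0 s1; rewrite /gain.
set e := expR _; have e0 : 0 < e by exact: expR_gt0.
case: (total_utility_cases gamma hp C0) => [-> _|[r _ ->]].
  by rewrite !gt0_muleNy ?lte_fin// addNye leNye.
case: (total_utility_cases gamma hp C'0) => [-> _|[r' _ ->]].
  by rewrite !(gt0_muleNy (x := e%:E), gt0_muleNy (x := s%:E)) ?lte_fin// addeNy leNye.
rewrite -!EFinM -EFinD => H.
apply: (@le_trans _ _ (e%:E * ((1 - s) * (\sum_i p i * r i) + s * (\sum_i p i * r' i))%:E)%E).
  by rewrite -EFinM lee_fin le_eqVlt; apply/orP; left; apply/eqP; ring.
by rewrite lee_pmul2l ?lte_fin.
Qed.

Hypothesis hV : forall x, pos_orthant x -> V x \is a fin_num.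

(* The payoff of the perturbed control is concave in the size of the perturbation,
   so its right derivative at 0 is at least its increment on [0, 1], which is
   positive. *)
Lemma marginal_value_gt0 x C i : pos_orthant x -> adm x C -> J C = V x ->
  differentiable v x -> 0 < (N^T *m gradient v x) i 0.
Proof.
move=> x0 aC JC dv; have [g [g0 g1 ag]] := admissible_impulse metzler i hN.
set y := N *m delta_mx i 0 in ag.
have y0 : orthant y by apply: hN => j; rewrite mxE ler0n.
have [Cs CsE] : exists Cs : R -> R -> 'cV[R]_n,
    forall s, Cs s = fun t => C t + s *: (g t *: (delta_mx i 0 : 'cV[R]_n)).
  by exists (fun s t => C t + s *: (g t *: (delta_mx i 0 : 'cV[R]_n))).
have aCs s : 0 <= s -> adm (x + s *: y) (Cs s).
  by move=> s0; rewrite CsE; exact: admissible_cone.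
have xs s : 0 <= s -> pos_orthant (x + s *: y).
  by move=> s0 j; rewrite mxE [(s *: y) j 0]mxE ltr_pwDl// mulr_ge0.
have C0 t : 0 <= t -> orthant (C t) by exact: aC.1.1.
have CCs t j : C t j 0 <= Cs 1 t j 0.
  by rewrite CsE scale1r !mxE lerDl mulr_ge0// ler0n.
have mG s : 0 <= s -> measurable_fun (`[0, +oo[ : set R) (G (Cs s)).
  by move=> s0; apply: measurable_gain; exact: (aCs s s0).1.
have mGC : measurable_fun (`[0, +oo[ : set R) (G C) by apply: measurable_gain; exact: aC.1.
have G1 t : 0 <= t -> (G C t <= G (Cs 1%R) t)%E.
  move=> t0; rewrite /gain lee_pmul2l ?lte_fin ?expR_gt0//.
  have C1 : orthant (Cs 1 t) by move=> j; exact: le_trans (C0 t t0 j) (CCs t j).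
  apply: lee_sum => j _; rewrite lee_pmul2l ?lte_fin//.
  have := CCs t j; rewrite le_eqVlt => /predU1P[->//|cj].
  by apply/ltW/utility_incr => //; exact: C0.
have J1 : (J C <= J (Cs 1%R))%E.
  apply: measurable_le_integral => //; first exact: mG.
  by move=> t; rewrite /= in_itv/= andbT; exact: G1.
have fJ : J C \is a fin_num by rewrite JC hV.
(* Squeezed between the finite payoff of [C] and the finite value at the interior point [x + y]. *)
have fJ1 : J (Cs 1%R) \is a fin_num.
  have := payoff_le_value (aCs 1 ler01); have := hV (xs 1 ler01).
  rewrite !fin_numE => /andP[_ Vy] JV; apply/andP; split.
    apply/eqP => Jy; move: J1; rewrite Jy leeNy_eq => /eqP JNy.
    by move: fJ; rewrite JNy.
  apply/eqP => Jy; move: JV; rewrite Jy leye_eq => /eqP VE.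
  by rewrite VE in Vy.
have iG : leb.-integrable `[0, +oo[ (G C).
  by apply: integral_fin_num_integrable; [|exact: mGC|exact: fJ].
have iG1 : leb.-integrable `[0, +oo[ (G (Cs 1%R)).
  by apply: integral_fin_num_integrable; [|exact: (mG 1 ler01)|exact: fJ1].
have Jlt : fine (J C) < fine (J (Cs 1%R)).
  have Jle : fine (J C) <= fine (J (Cs 1)) by exact: (fine_le fJ fJ1 J1).
  rewrite lt_neqAle Jle andbT.
  (* Equal payoffs would force the ordered integrands to agree almost everywhere, in particular at
     some time in [0, 1[, where the extra consumption [g] is positive. *)
  apply/eqP => E; have JE : J C = J (Cs 1) := etrans (etrans (esym (fineK fJ)) (congr1 EFin E)) (fineK fJ1).
  have aeE : {ae leb, forall t, 0 <= t -> G C t \is a fin_num /\ G C t = G (Cs 1) t}.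
    have H : {ae leb, forall t, `[0, +oo[%classic t -> G C t \is a fin_num /\ G C t = G (Cs 1) t}.
      apply: le_integral_eq_ae; [exact: measurable_itv|exact: iG|exact: iG1| |exact: JE].
      by move=> t; rewrite /= in_itv/= andbT; exact: G1.
    by apply: ae_imp H => t; rewrite /= in_itv/= andbT.
  have [t [t0 t1 /(_ t0)[f1 /eqP]]] := ae_itv_exists ltr01 aeE.
  suff GL : (G C t < G (Cs 1%R) t)%E by rewrite (lt_eqF GL).
  apply: (gain_incr hgamma hp (C0 t t0) (CCs t) (i := i)); last exact: f1.
  by rewrite CsE scale1r !mxE !eqxx mulr1 ltrDl g1.
have vx : v x = fine (J C) by rewrite /fine_value JC.
have JCE : (v x)%:E = J C := etrans (congr1 EFin vx) (fineK fJ).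
have [r J1E vr] : exists2 r, r%:E = J (Cs 1) & v x < r.
  by exists (fine (J (Cs 1))); [exact: (fineK fJ1)|rewrite vx; exact: Jlt].
have key s : 0 < s -> s < 1 -> (1 - s) * v x + s * r <= v (x + s *: y).
  move=> s0 s1; rewrite -lee_fin [leRHS](fineK (hV (xs s (ltW s0)))).
  apply: (le_trans _ (payoff_le_value (aCs s (ltW s0)))).
  rewrite EFinD !EFinM JCE J1E.
  apply: le_integral_linear; [exact: measurable_itv|exact: iG|exact: iG1|exact: (mG s (ltW s0))|].
  move=> t; rewrite /= in_itv/= andbT => t0.
  have := @gain_concave C (Cs 1%R) s t (C0 t t0) (CCs t) s0 s1.
  rewrite (_ : (fun t => C t + s *: (Cs 1 t - C t)) = Cs s)//.
  by apply/funext => u; rewrite !CsE scale1r addrAC subrr add0r.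
have grad_ge := directional_derivative_ge dv key.
have -> : (N^T *m gradient v x) i 0 = \sum_j gradient v x j 0 * y j 0.
  rewrite mxE; apply: eq_bigr => j _.
  by rewrite /y -colE !mxE mulrC.
by apply: lt_le_trans grad_ge; rewrite subr_gt0.
Qed.

End DynamicProgramming.

(** * The Hamilton-Jacobi-Bellman equation *)

Section Differentiation.
Context {R : realType} {n : nat}.
Local Notation leb := (@lebesgue_measure R).

(** Lebesgue differentiation applies to the restriction of [f] to each [0, m]; the exceptional sets
    for all m form a single null set. *)
Lemma loc_integrable_ae_derive (f : R -> R) : loc_integrable f ->
  {ae leb, forall t : R, 0 < t ->
    is_derive t (1 : R) (fun y => \int[leb]_(s in `[0, y]) f s) (f t)}.
Proof.
move=> lf; pose fm (m : nat) := f \_ `[0, m%:R].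
have aem (m : nat) : {ae leb, forall t : R, 0 < t ->
    is_derive t (1 : R) (fun y => \int[leb]_(s in `[0, y]) fm m s) (fm m t)}.
  have lfm := integrable_locally (measurable_itv _) (lf m%:R (ler0n _ _)).
  have ifm : leb.-integrable setT (EFin \o fm m).
    by rewrite -restrict_EFin; apply/(integrable_mkcond _ _).1 => //; exact: (lf _ (ler0n _ _)).
  have ifmy (y : R) : leb.-integrable [set` Interval (BLeft 0) (BRight y)] (EFin \o fm m).
    by apply: integrableS ifm.
  have := FTC1 ifmy lfm; apply: ae_imp => t H t0.
  by have [d1 d2] := H t0; split; [exact: d1|rewrite -derive1E; exact: d2].
have := ae_foralln aem; apply: ae_imp => t H t0.
(* Strictly above [t], so [0, m] still contains [0, y] for every y near [t] with y >= 0, where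
   restricting [f] changes nothing. *)
pose m := (Num.truncn t).+1.
have tm : t < m%:R by exact: truncnS_gt.
have := H m t0; have -> : f t = fm m t.
  by rewrite /fm patchE mem_set//= in_itv/= !ltW.
apply: near_eq_is_derive; near=> y; apply: eq_Rintegral => s; rewrite inE/= in_itv/= => /andP[s0 sy].
rewrite /fm patchE mem_set//= in_itv/= s0/= (le_trans sy)//.
by apply/ltW; near: y; exact: lt_nbhsl.
Unshelve. all: by end_near. Qed.

Lemma is_derive_discount (rho t : R) (w : 'cV[R]_n -> R) (X : R -> 'cV[R]_n) (X' : 'cV[R]_n) :
  differentiable w (X t) ->
  (forall i, is_derive t (1 : R) (fun s => X s i 0) (X' i 0)) ->
  is_derive t (1 : R) (fun s => expR (- rho * s) * w (X s))
    (expR (- rho * t) * (\sum_i gradient w (X t) i 0 * X' i 0 - rho * w (X t))).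
Proof.
move=> dw dX; apply: (is_derive_congr (is_deriveM (is_derive_expRM rho t) (is_derive_gradient dw dX))) => //.
by rewrite /GRing.scale/=; ring.
Qed.

(** The first term of the hypothesis is the discounted integral of the constant utility [r] over
    [0, h]. Both sides agree at h = 0, so the inequality passes to right derivatives. *)
Lemma discounted_value_le (rho r : R) (w : 'cV[R]_n -> R) (X : R -> 'cV[R]_n) (X' : 'cV[R]_n) :
  0 < rho -> differentiable w (X 0) ->
  (forall i, is_derive (0 : R) (1 : R) (fun s => X s i 0) (X' i 0)) ->
  (\forall h \near 0^'+, (1 - expR (- rho * h)) / rho * r + expR (- rho * h) * w (X h) <= w (X 0)) ->
  r - rho * w (X 0) + \sum_i gradient w (X 0) i 0 * X' i 0 <= 0.
Proof.
move=> rho0 dw dX H.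
pose f h := - ((1 - expR (- rho * h)) / rho * r + expR (- rho * h) * w (X h)).
have d1 := is_derive_discount rho dw dX.
have d2 : is_derive (0 : R) (1 : R) (fun h : R => (1 - expR (- rho * h)) / rho * r) r.
  have d := is_derive_expRM rho 0.
  pose cst_der (x : R) := is_derive_cst x (0 : R) (1 : R).
  apply: (is_derive_congr (is_deriveM
    (is_deriveM (is_deriveB (cst_der 1) d) (cst_der rho^-1)) (cst_der r))) => //.
  rewrite /GRing.scale/= !fctE/= !mulr0 expR0; field; exact: lt0r_neq0.
have df := is_deriveN (is_deriveD d2 d1).
rewrite -oppr_ge0; set D := - _.
have {}df : is_derive (0 : R) (1 : R) f D.
  apply: (is_derive_congr df) => //; rewrite /D mulr0 expR0 mul1r; ring.
apply: (is_derive_right_ge0 df); near=> h.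
rewrite addr0 /f mulr0 expR0 subrr !mul0r add0r mul1r lerN2.
by near: h.
Unshelve. all: by end_near. Qed.

Lemma discounted_value_eq (rho t f0 j0 : R) (F : R -> R) (w : 'cV[R]_n -> R)
    (X : R -> 'cV[R]_n) (X' : 'cV[R]_n) : differentiable w (X t) ->
  (forall i, is_derive t (1 : R) (fun s => X s i 0) (X' i 0)) ->
  is_derive t (1 : R) F f0 ->
  (\forall s \near t, F s + expR (- rho * s) * w (X s) = j0) ->
  f0 + expR (- rho * t) * (\sum_i gradient w (X t) i 0 * X' i 0 - rho * w (X t)) = 0.
Proof.
move=> dw dX dF H.
have d1 := is_deriveD dF (is_derive_discount rho dw dX).
have : is_derive t (1 : R) (fun=> j0)
    (f0 + expR (- rho * t) * (\sum_i gradient w (X t) i 0 * X' i 0 - rho * w (X t))).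
  by apply: near_eq_is_derive d1.
by move=> [_ <-]; rewrite derive_cst.
Qed.

Lemma continuous_pos_orthant_near (X : R -> 'cV[R]_n) (t : R) :
  (forall i, {for t, continuous (fun s => X s i 0)}) -> pos_orthant (X t) ->
  \forall s \near t, pos_orthant (X s).
Proof.
move=> cX Xt.
have H i : \forall s \near t, 0 < X s i 0 by have /cvgr_gt := cX i; apply; exact: Xt.
by near=> s => i; move: i; near: s; exact: filter_forall H.
Unshelve. all: by end_near. 
Qed.

Lemma is_derive_continuous (f : R -> R) (t d : R) : is_derive t (1 : R) f d ->
  {for t, continuous f}.
Proof. by move=> [df _]; apply/differentiable_continuous/derivable1_diffP. Qed.

Lemma integral_discount (rho r h : R) : 0 < rho -> 0 < h ->
  (\int[leb]_(t in `[0%R, h[) ((expR (- rho * t))%:E * r%:E) =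
   ((1 - expR (- rho * h)) / rho * r)%:E)%E.
Proof.
move=> rho0 h0.
have cE : continuous (fun t : R => expR (- rho * t) * r).
  by move=> t; apply: cvgMr_tmp; exact: (is_derive_continuous (is_derive_expRM rho t)).
have mE : measurable_fun (`[0, h[ : set R) (EFin \o (fun t : R => expR (- rho * t) * r)).
  by apply: measurable_funTS; apply/measurable_EFinP; exact: continuous_measurable_fun.
rewrite [LHS](_ : _ = \int[leb]_(t in `[0%R, h[) (expR (- rho * t) * r)%:E)%E; last first.
  by apply: eq_integral => t _; rewrite EFinM.
rewrite integral_itv_bndo_bndc//.
pose F (t : R) := - (expR (- rho * t) / rho * r).
have rn0 : rho != 0 by exact: lt0r_neq0.
have dF t : is_derive t (1 : R) F (expR (- rho * t) * r).
  have d := is_deriveN (is_deriveM (is_deriveM (is_derive_expRM rho t)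
    (is_derive_cst rho^-1 t (1 : R))) (is_derive_cst r t (1 : R))).
  by apply: (is_derive_congr d) => //; rewrite /GRing.scale/= !fctE/=; field.
rewrite (@continuous_FTC2 _ _ F)//.
- by rewrite -EFinB /F mulr0 expR0; congr (_%:E); field.
- by apply: continuous_subspaceT; exact: cE.
- split=> [x _||].
  + by have [] := dF x.
  + by apply: cvg_at_right_filter; exact: (is_derive_continuous (dF 0)).
  + by apply: cvg_at_left_filter; exact: (is_derive_continuous (dF h)).
- by move=> x _; rewrite derive1E; have [_ ->] := dF x.
Qed.

End Differentiation.

(** * The feedback map and the continuous representative of the control *)

Section Feedback.
Context {R : realType} {n : nat}.
Local Notation leb := (@lebesgue_measure R).
Variables (N : 'M[R]_n) (gamma : R) (p : 'I_n -> R).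
Hypotheses (hgamma : 0 < gamma) (hp : forall i, 0 < p i).
Implicit Types (q c : 'cV[R]_n) (i j : 'I_n).

Lemma c_hatE q i : c_hat N gamma p q i 0 = (p i / (N^T *m q) i 0) `^ gamma^-1.
Proof. by rewrite mxE. Qed.

Lemma c_hat_gt0 q : pos_orthant (N^T *m q) -> pos_orthant (c_hat N gamma p q).
Proof. by move=> q0 i; rewrite c_hatE powR_gt0// divr_gt0. Qed.

Lemma c_hat_ge0 q : orthant (c_hat N gamma p q).
Proof. by move=> i; rewrite c_hatE powR_ge0. Qed.

Lemma c_hat_first_order q i : 0 < (N^T *m q) i 0 ->
  p i * c_hat N gamma p q i 0 `^ (- gamma) = (N^T *m q) i 0.
Proof.
move=> m0; rewrite c_hatE; set m := (_ *m _) _ _ in m0 *.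
have mn0 : m != 0 by exact: lt0r_neq0.
have pn0 : p i != 0 by exact: lt0r_neq0.
rewrite -powRrM mulrN mulVf ?lt0r_neq0// powR_inv1 ?divr_ge0 ?ltW//.
by field; rewrite mn0 pn0.
Qed.

(** The problem separates into coordinates. By the first-order condition, the tangent of the utility
    at [c_hat] makes each [gap] nonpositive, and negative where [c] differs from [c_hat]; the
    hypothesis says that the gaps have nonnegative sum. *)
Lemma maximizer_c_hat q c (r : 'I_n -> R) : orthant c -> pos_orthant (N^T *m q) ->
  (forall i, utility gamma (c i 0) = (r i)%:E) ->
  \sum_i (p i * rutility gamma (c_hat N gamma p q i 0) -
          (N^T *m q) i 0 * c_hat N gamma p q i 0) <=
  \sum_i (p i * r i - (N^T *m q) i 0 * c i 0) ->
  c = c_hat N gamma p q.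
Proof.
move=> c0 q0 rE; rewrite -subr_ge0 -sumrB => Hsum.
pose gap i := (p i * r i - (N^T *m q) i 0 * c i 0) -
  (p i * rutility gamma (c_hat N gamma p q i 0) - (N^T *m q) i 0 * c_hat N gamma p q i 0).
have gap_lt i : c i 0 != c_hat N gamma p q i 0 -> gap i < 0.
  have := c_hat_first_order (q0 i); have := c_hat_gt0 q0 i.
  rewrite /gap; set h := c_hat _ _ _ _ _ _; set m := (_ *m _) _ _ => h0 foc ch.
  have := utility_tangent_lt hgamma h0 (c0 i) ch.
  rewrite rE lte_fin; set D := _ `^ _ in foc *; set u := rutility _ _ => H.
  have : p i * r i < p i * (u + D * (c i 0 - h)) by rewrite ltr_pM2l.
  have -> : p i * (u + D * (c i 0 - h)) = p i * u + (p i * D) * (c i 0 - h) by ring.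
  by rewrite foc; lra.
have gap_le i : gap i <= 0.
  have [E|/gap_lt/ltW//] := eqVneq (c i 0) (c_hat N gamma p q i 0).
  have := rE i; rewrite E utility_gt0 ?c_hat_gt0// => -[rr].
  by rewrite /gap E rr subrr.
apply/colP => i; apply/eqP; apply: contraT => /gap_lt gi.
suff : \sum_i gap i < 0 by rewrite ltNge Hsum.
by rewrite (bigD1 i)//= ltr_nwDl// sumr_le0.
Qed.

Lemma cvg_col (T : Type) (F : set_system T) (FF : Filter F) (f : T -> 'cV[R]_n) (c : 'cV[R]_n) :
  (forall i, f s i 0 @[s --> F] --> c i 0) -> f @ F --> c.
Proof.
move=> fc; apply/cvgrPdist_le => /= e e0; near=> s.
rewrite [leLHS]/Num.Def.normr/= mx_normrE (bigmax_le _ (ltW e0))//= => -[i j] _.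
rewrite (ord1 j) !mxE/=; move: i {j}; near: s; apply: filter_forall => i.
exact: ((cvgrPdist_le _ _).1 (fc i)).
Unshelve. all: by end_near. Qed.

Lemma c_hat_continuous q : pos_orthant (N^T *m q) ->
  {for q, continuous (c_hat N gamma p)}.
Proof.
move=> q0; apply: (@cvg_col _ (nbhs q)) => i; rewrite c_hatE.
under eq_cvg do rewrite c_hatE.
have m0 := q0 i.
have cm : (N^T *m s) i 0 @[s --> q] --> (N^T *m q) i 0.
  rewrite mxE; under eq_cvg do rewrite mxE.
  apply: (@cvg_big _ _ _ _ _ _ _ (nbhs q)) => [|j _]; first exact: add_continuous.
  apply: cvgMl_tmp; exact: (differentiable_continuous (differentiable_coord q j 0)).
apply: (cvg_comp _ (fun x : R => (p i / x) `^ gamma^-1) cm).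
have cq : p i / x @[x --> (N^T *m q) i 0] --> p i / (N^T *m q) i 0.
  by apply: cvgMl_tmp; apply: cvgV; [exact: lt0r_neq0|exact: cvg_id].
apply: (cvg_comp _ (fun x : R => x `^ gamma^-1) cq).
have := @is_derive1_powR R gamma^-1 (p i / (N^T *m q) i 0) (divr_gt0 (hp i) m0).
exact: is_derive_continuous.
Qed.

Variables (Q : 'cV[R]_n -> 'cV[R]_n) (C K : R -> 'cV[R]_n).
Hypotheses (cK : {within `[0, +oo[, continuous K}) (iC : L1loc_orthant C).
Hypothesis cQ : forall x, pos_orthant x -> {for x, continuous Q}.
Hypothesis NQ : forall t, 0 <= t -> pos_orthant (K t) -> pos_orthant (N^T *m Q (K t)).
Hypothesis CE : {ae leb, forall t : R, 0 < t -> pos_orthant (K t) ->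
  C t = c_hat N gamma p (Q (K t))}.

Let fb t := c_hat N gamma p (Q (K t)).
(** At the remaining times the given control is kept, so that the two differ only on a null set. *)
Let Chat t := if `[< 0 <= t /\ pos_orthant (K t) >] then fb t else C t.

Lemma within_pos_orthant_near (t : R) : 0 <= t -> pos_orthant (K t) ->
  \forall s \near within `[0, +oo[ (nbhs t), pos_orthant (K s).
Proof.
move=> t0 Kt; have tI : `[0, +oo[%classic t by rewrite /= in_itv/= t0.
have H i : \forall s \near within `[0, +oo[ (nbhs t), 0 < K s i 0.
  have /subspace_continuousP/(_ t tI)/cvgr_gt := within_continuous_coord (i := i) cK.
  by apply; exact: Kt.
by near=> s => i; move: i; near: s; exact: filter_forall H.
Unshelve. all: by end_near. Qed.

Lemma feedback_continuous (t : R) : 0 <= t -> pos_orthant (K t) ->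
  fb s @[s --> within `[0, +oo[ (nbhs t)] --> fb t.
Proof.
move=> t0 Kt; have tI : `[0, +oo[%classic t by rewrite /= in_itv/= t0.
have /subspace_continuousP/(_ t tI) cKt := cK.
apply: (cvg_comp _ (fun x => c_hat N gamma p (Q x)) cKt).
apply: (cvg_comp _ (c_hat N gamma p) (cQ Kt)).
exact: c_hat_continuous (NQ t0 Kt).
Qed.

(** Being interior is preserved nearby by continuity of [K], so around an interior time [Chat] is
    the continuous feedback. Local integrability comes from almost everywhere equality with [C] once
    [Chat] is known to be measurable. *)
Lemma optimal_representative : exists Chat : R -> 'cV[R]_n,
    L1loc_orthant Chat /\ ae_equal Chat C /\
    forall t : R, 0 <= t -> pos_orthant (K t) ->
      Chat s @[s --> within `[0, +oo[ (nbhs t)] --> Chat t /\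
      pos_orthant (Chat t) /\ Chat t = c_hat N gamma p (Q (K t)).
Proof.
have ChatE t : 0 <= t -> pos_orthant (K t) -> Chat t = fb t.
  by move=> t0 Kt; rewrite /Chat asboolT.
have aeE : {ae leb, forall t : R, 0 <= t -> Chat t = C t}.
  (* The almost everywhere formula concerns positive times; time 0 is discarded as a null set. *)
  have ae0 : {ae leb, forall t : R, t != 0}.
    exists [set 0]; split; [exact: measurable_set1|exact: lebesgue_measure_set1|].
    by move=> t /= /negP; rewrite negbK => /eqP.
  apply: ae_imp (ae_and CE ae0) => t [H tn0] t0.
  rewrite /Chat; case: asboolP => // -[_ Kt]; rewrite H// lt_neqAle eq_sym tn0//.
exists Chat; split; last split; [|exact: aeE|]; last first.
  move=> t t0 Kt; rewrite ChatE//; split; last first.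
    by split=> //; apply: c_hat_gt0; exact: NQ.
  have := feedback_continuous t0 Kt; apply: cvg_trans; apply: near_eq_cvg.
  have Hp := within_pos_orthant_near t0 Kt.
  have H0 : \forall s \near within `[0, +oo[ (nbhs t), 0 <= s.
    by rewrite near_withinE; apply: nearW => s; rewrite /= in_itv/= andbT.
  by near=> s; rewrite ChatE//; near: s.
split=> [t t0|i T T0].
  rewrite /Chat; case: asboolP => [_|_]; first exact: c_hat_ge0.
  exact: iC.1.
pose D : set R := [set t | 0 <= t /\ pos_orthant (K t)].
(* [Chat] is defined by cases on [D], so its measurability needs that of [D], which is a finite
   intersection of preimages under the continuous coordinates of [K]. *)
have mD : measurable D.
  have -> : D = \bigcap_(j in [set: 'I_n]) (`[0, +oo[%classic `&` (fun s : R => K s j 0) @^-1` `]0, +oo[%classic)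
      `&` `[0, +oo[%classic.
    apply/seteqP; split=> [t [t0 Kt]|t []].
      split; last by rewrite /= in_itv/= t0.
      by move=> j _; split; rewrite /= in_itv/= ?t0// Kt.
    move=> H; rewrite /= in_itv/= andbT => t0; split=> // j.
    by have [_] := H j I; rewrite /= in_itv/= andbT.
  apply: measurableI => //; apply: fin_bigcap_measurable; first exact: finite_finset.
  move=> j _; have mK : measurable_fun (`[0, +oo[ : set R) (fun s : R => K s j 0).
    apply: subspace_continuous_measurable_fun => //.
    exact: within_continuous_coord.
  exact: mK.
have mfb : measurable_fun D (fun t => fb t i 0).
  apply: subspace_continuous_measurable_fun => //.
  apply/subspace_continuousP => t [t0 Kt].
  have c1 : fb s i 0 @[s --> within `[0, +oo[ (nbhs t)] --> fb t i 0.
    apply: (cvg_comp _ (fun M : 'cV[R]_n => M i 0) (feedback_continuous t0 Kt)).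
    exact: (differentiable_continuous (differentiable_coord (fb t) i 0)).
  apply: cvg_trans c1; apply: cvg_app => P HP.
  have {}HP : nbhs t (fun s => `[0, +oo[%classic s -> P s) := HP.
  suff: nbhs t (fun s => D s -> P s) by [].
  by apply: filterS HP => s H [s0 _]; apply: H; rewrite /= in_itv/= s0.
have mC : measurable_fun (`[0, T] : set R) (fun t => C t i 0).
  by have /integrableP[/measurable_EFinP] := iC.2 i T T0.
have mChat : measurable_fun (`[0, T] : set R) (fun t => Chat t i 0).
  rewrite (_ : (fun t => _) = (fun t => if t \in D then fb t i 0 else C t i 0)); last first.
    by apply/funext => t; rewrite /Chat; case: asboolP => Dt; [rewrite mem_set|rewrite memNset].
  apply: measurable_fun_if => //.
  - apply: (measurable_fun_bool true) => //.
    rewrite (_ : _ @^-1` _ = D); first exact: measurableI.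
    by apply/seteqP; split=> t /= Dt; [exact: set_mem|exact: mem_set].
  - apply: measurable_funS mfb => //; by move=> t [_ /set_mem].
  - by apply: measurable_funS mC => // t [].
apply: (integrable_ae_eq _ _ _ (iC.2 i T T0)) => //; first exact/measurable_EFinP.
by apply: ae_imp aeE => t H; rewrite /= in_itv/= => /andP[t0 _]; rewrite H.
Unshelve. all: by end_near. Qed.

End Feedback.

(** * The Hamilton-Jacobi-Bellman equation along the optimal trajectory *)

Section HamiltonJacobiBellman.
Context {R : realType} {n : nat}.
Local Notation leb := (@lebesgue_measure R).
Variables (L A N : 'M[R]_n) (rho gamma : R) (p : 'I_n -> R).
Hypotheses (hrho : 0 < rho) (hgamma : 0 < gamma) (hp : forall i, 0 < p i).
Hypothesis metzler : forall i j, i != j -> 0 <= (L + A) i j.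
Hypothesis hN : preserves_orthant N.
Implicit Types (x k c : 'cV[R]_n) (C K : R -> 'cV[R]_n) (a s t h : R) (i j : 'I_n).

Local Notation V := (value L A N rho gamma p).
Local Notation v := (fine_value L A N rho gamma p).
Local Notation J := (payoff rho gamma p).
Local Notation G := (gain rho gamma p).

Hypothesis hV : forall x, pos_orthant x -> V x \is a fin_num.
Hypothesis dV : forall x, pos_orthant x -> differentiable v x.

Lemma L1loc_orthant_cst c : orthant c -> L1loc_orthant (fun=> c).
Proof.
move=> c0; split=> [t _|i]; first exact: c0.
by apply: within_continuous_loc_integrable; apply: continuous_subspaceT; exact: cst_continuous.
Qed.

(** Following [constant_path] for a time [h] is a competitor for the value at [x]; the inequality of
    [value_ge_concat] is differentiated at h = 0. *)
Lemma hjb_le x c : pos_orthant x -> pos_orthant c ->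
  \sum_i p i * rutility gamma (c i 0) - rho * v x +
    \sum_i gradient v x i 0 * ((L + A) *m x - N *m c) i 0 <= 0.
Proof.
move=> x0 c0; pose X := constant_path L A N x c.
have X0 : X 0 = x by exact: constant_path0.
have iC := L1loc_orthant_cst (fun i => ltW (c0 i)).
have SX : state_solution L A N x (fun=> c) X by exact: constant_path_solution.
have nearX : \forall s \near (0 : R), pos_orthant (X s).
  apply: continuous_pos_orthant_near => [i|]; last by rewrite X0.
  exact: (is_derive_continuous (constant_path_is_derive L A N x c 0 i)).
(* Up to time [e] the path stays interior, where the value is finite and [fine_value] represents
   it. *)
have [e /= e0 He] := (nbhs_ballP _ _).1 nearX.
set r := \sum_i _.
have step h : 0 < h -> h < e ->
    (1 - expR (- rho * h)) / rho * r + expR (- rho * h) * v (X h) <= v x.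
  move=> h0 he; have posX s : 0 <= s -> s <= h -> pos_orthant (X s).
    move=> s0 sh; apply: He; rewrite /ball/= sub0r normrN ger0_norm//.
    exact: le_lt_trans he.
  have IE : (\int[leb]_(t in `[0%R, h[) G (fun=> c) t = ((1 - expR (- rho * h)) / rho * r)%:E)%E.
    rewrite -integral_discount//; apply: eq_integral => t _.
    by rewrite /gain total_utility_gt0.
  have K0 s : 0 <= s < h -> orthant (X s).
    by move=> /andP[s0 /ltW sh] i; apply/ltW/posX.
  have fI : (\int[leb]_(t in `[0%R, h[) G (fun=> c) t)%E \is a fin_num by rewrite IE.
  have := value_ge_concat (ltW h0) iC SX K0 (hV (posX h (ltW h0) (lexx h))) (hV x0) fI.
  by rewrite IE.
have := @discounted_value_le R n rho r v X ((L + A) *m X 0 - N *m c) hrho.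
rewrite X0; apply; first exact: dV.
  by move=> i; have := constant_path_is_derive L A N x c 0 i; rewrite constant_path0.
near=> h; apply: step; near: h; [exact: nbhs_right_gt|exact: nbhs_right_lt].
Unshelve. all: by end_near. Qed.

Variables (k : 'cV[R]_n) (C K : R -> 'cV[R]_n).
Hypothesis hC : is_the_optimal L A N rho gamma p k C.
Hypothesis SK : state_solution L A N k C K.
Hypothesis K0 : forall t, 0 <= t -> orthant (K t).
Variable i0 : 'I_n.

Let iC : L1loc_orthant C. Proof. exact: hC.1.1.1. Qed.

Lemma optimal_shift t : 0 <= t -> pos_orthant (K t) ->
  J C \is a fin_num /\ J (fun s => C (s + t)) = V (K t).
Proof.
by move=> t0 Kt; exact: (optimal_tail hrho hgamma hp metzler hN i0 hC SK K0 t0 Kt (hV Kt)).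
Qed.

Lemma gradient_N_gt0 t : 0 <= t -> pos_orthant (K t) ->
  pos_orthant (N^T *m gradient v (K t)).
Proof.
move=> t0 Kt i; have [_ JV] := optimal_shift t0 Kt.
have aC := admissible_shift t0 iC SK K0.
exact: (marginal_value_gt0 hgamma hp metzler hN hV i Kt aC JV (dV Kt)).
Qed.

(** Splitting the optimal payoff at [t] and using optimality of the tail. Finiteness of [J C] makes
    the gain integrable, so passing to real values with [fine] does not change the integral. *)
Lemma gain_integral_eq t : 0 <= t -> pos_orthant (K t) ->
  \int[leb]_(s in `[0, t]) fine (G C s) + expR (- rho * t) * v (K t) = fine (J C).
Proof.
move=> t0 Kt; have [fJ JV] := optimal_shift t0 Kt.
have iG : leb.-integrable `[0, +oo[ (G C).
  by apply: integral_fin_num_integrable; [|exact: measurable_gain|exact: fJ].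
have iGt : leb.-integrable `[0, t[ (G C).
  by apply: integrableS iG => // s; rewrite /= !in_itv/= => /andP[->].
have mI : measurable (`[0, t[%classic : set (measurableTypeR R)) by exact: measurable_itv.
have [iF IE] := integrable_fine mI iGt.
have JE := payoff_split rho gamma p iC t0.
rewrite JE JV IE -(fineK (hV Kt)) -EFinM -EFinD.
by congr (_ + _); rewrite -Rintegral_itv_bndo_bndc.
Qed.

Lemma hjb_eq_ae : {ae leb, forall t, 0 < t -> pos_orthant (K t) ->
  exists2 r : 'I_n -> R, (forall i, utility gamma (C t i 0) = (r i)%:E) &
    \sum_i p i * r i - rho * v (K t) +
      \sum_i gradient v (K t) i 0 * ((L + A) *m K t - N *m C t) i 0 = 0}.
Proof.
(* Without an interior time the claim is vacuous; a single one makes [J C] finite, hence the gain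
   integrable on the whole half-line. *)
have [[a [a0 Ka]]|nK] := pselect (exists a, 0 <= a /\ pos_orthant (K a)); last first.
  by apply: aeW => t t0 Kt; exfalso; apply: nK; exists t; split=> //; exact: ltW.
have [fJ _] := optimal_shift a0 Ka.
have iG : leb.-integrable `[0, +oo[ (G C).
  by apply: integral_fin_num_integrable; [|exact: measurable_gain|exact: fJ].
pose f s := fine (G C s).
have lf : loc_integrable f.
  move=> T T0.
  have mI : measurable (`[0, T]%classic : set (measurableTypeR R)) by exact: measurable_itv.
  suff iGT : leb.-integrable `[0, T] (G C) by exact: (integrable_fine mI iGT).1.
  by apply: integrableS iG => // s; rewrite /= !in_itv/= => /andP[->].
have mI : measurable (`[0, +oo[%classic : set (measurableTypeR R)) by exact: measurable_itv.
have aeG := integrable_ae mI iG.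
have aef := loc_integrable_ae_derive lf.
have aeK := ae_forall_ord (fun i => loc_integrable_ae_derive (loc_integrable_rate L A N i iC SK.1)).
apply: ae_imp (ae_and aeG (ae_and aef aeK)) => t [fG [dF dK]] t0 Kt.
have dKi i : is_derive t (1 : R) (fun s => K s i 0) (((L + A) *m K t - N *m C t) i 0).
  have d := is_deriveD (is_derive_cst (k i 0) t (1 : R)) (dK i t0).
  rewrite add0r in d; apply: near_eq_is_derive d.
  near=> s; rewrite fctE/= SK.2//; apply/ltW; near: s; exact: lt_nbhsr.
(* The conserved quantity is known only at interior times, and a whole neighbourhood of them is
   needed to differentiate it. *)
have nearK : \forall s \near t, pos_orthant (K s).
  by apply: continuous_pos_orthant_near => // i; exact: (is_derive_continuous (dKi i)).
have near0 : \forall s \near t, 0 < s by exact: lt_nbhsr.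
have H : \forall s \near t, \int[leb]_(u in `[0, s]) f u + expR (- rho * s) * v (K s) = fine (J C).
  near=> s; apply: gain_integral_eq; first by apply/ltW; near: s.
  by near: s.
have := discounted_value_eq (dV Kt) dKi (dF t0) H.
have {}fG : G C t \is a fin_num by apply: fG; rewrite /= in_itv/= ltW.
have e0 := expR_gt0 (- rho * t).
have C0 : orthant (C t) by apply: iC.1; exact: ltW.
move: fG; rewrite /f /gain; case: (total_utility_cases gamma hp C0) => [->|[r rE ->]].
  by rewrite gt0_muleNy ?lte_fin.
move=> _; rewrite -EFinM [fine _]/= -mulrDr => /eqP.
rewrite mulf_eq0 gt_eqF//= => /eqP E; exists r => //.
by rewrite -addrA [- _ + _]addrC.
Unshelve. all: by end_near. Qed.

Lemma optimal_feedback_ae : {ae leb, forall t, 0 < t -> pos_orthant (K t) ->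
  C t = c_hat N gamma p (gradient v (K t))}.
Proof.
apply: ae_imp hjb_eq_ae => t H t0 Kt; have [r rE E] := H t0 Kt.
have q0 := gradient_N_gt0 (ltW t0) Kt; move: q0 E.
have := hjb_le Kt (c := c_hat N gamma p (gradient v (K t))).
move: (gradient v (K t)) (rho * v (K t)) => q w HJB q0 E.
apply: (maximizer_c_hat hgamma hp _ q0 rE); first by apply: iC.1; exact: ltW.
have {}HJB := HJB (c_hat_gt0 gamma hp q0).
(* Moving [N] to the other side of the scalar product isolates the part of the Hamiltonian that
   depends on [c]; the rest is common to the equation and the inequality and cancels. *)
have split_sum c : \sum_i q i 0 * ((L + A) *m K t - N *m c) i 0 =
    \sum_i q i 0 * ((L + A) *m K t) i 0 - \sum_i (N^T *m q) i 0 * c i 0.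
  have -> : \sum_i (N^T *m q) i 0 * c i 0 = \sum_i q i 0 * (N *m c) i 0.
    under eq_bigr do rewrite mxE mulr_suml.
    rewrite exchange_big/=; apply: eq_bigr => i _.
    by rewrite mxE mulr_sumr; apply: eq_bigr => j _; rewrite mxE; ring.
  rewrite -sumrB; apply: eq_bigr => i _.
  by rewrite [((L + A) *m K t - N *m c) i 0]mxE [(- (N *m c)) i 0]mxE mulrBr.
by move: HJB E; rewrite !split_sum !sumrB; lra.
Qed.

End HamiltonJacobiBellman.

Unset Implicit Arguments.

(** Controls are classes modulo null sets, so continuity and the pointwise formula are asserted of
    one representative [Chat]; the filter [within] makes continuity one-sided at time 0. Regularity
    of the value function enters through [hVfin] and [hVC1]. *)
Theorem corollary4p8 (R : realType) (n : nat) (hn : (2 <= n)%N)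
    (a : 'rV[R]_n) (ha : forall i, 0 < a 0 i)
    (L : 'M[R]_n) (hL : forall t : R, 0 <= t -> preserves_orthant (expmx (t *: L)))
    (N : 'M[R]_n) (hN : preserves_orthant N)
    (hNe : forall i : 'I_n, N *m (delta_mx i 0 : 'cV[R]_n) <> 0)
    (rho gamma : R) (hrho : 0 < rho) (hgamma : 0 < gamma)
    (p : 'I_n -> R) (hp : forall i, 0 < p i)
    (b : 'cV[R]_n) (lam : R) (hb : pos_orthant b) (hlam : 0 < lam)
    (hbeig : (L + diag_mx a)^T *m b = lam *: b)
    (hdom : dominates_spectrum (L + diag_mx a)^T lam)
    (hrholam : lam * (1 - gamma) < rho)
    (hVfin : forall x, pos_orthant x ->
       value L (diag_mx a) N rho gamma p x \is a fin_num)
    (hVC1 : continuously_differentiable pos_orthant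
       (fine_value L (diag_mx a) N rho gamma p))
    (k : 'cV[R]_n) (hk : orthant k)
    (C : R -> 'cV[R]_n) (hC : is_the_optimal L (diag_mx a) N rho gamma p k C)
    (K : R -> 'cV[R]_n) (hK : state_solution L (diag_mx a) N k C K) :
  exists Chat : R -> 'cV[R]_n,
    L1loc_orthant Chat /\ ae_equal Chat C /\
    forall t : R, 0 <= t -> pos_orthant (K t) ->
      Chat s @[s --> within `[0, +oo[ (nbhs t)] --> Chat t /\
      pos_orthant (Chat t) /\
      Chat t = c_hat N gamma p
        (gradient (fine_value L (diag_mx a) N rho gamma p) (K t)).
Proof.
have metzler i j : i != j -> 0 <= (L + diag_mx a) i j.
  move=> ij; rewrite !mxE (negbTE ij) mulr0n addr0.
  exact: (expmx_preserves_offdiag hL ij).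
have iC : L1loc_orthant C by exact: hC.1.1.1.
(* Admissibility provides some orthant-valued trajectory; uniqueness identifies the given [K] with
   it. *)
have K0 t : 0 <= t -> orthant (K t).
  move=> t0; have [_ [K' [SK' K0']]] := hC.1.1.
  by rewrite (state_solution_unique iC hK SK' t0); exact: K0'.
have dV x : pos_orthant x -> differentiable (fine_value L (diag_mx a) N rho gamma p) x.
  by move=> x0; exact: (hVC1 x x0).1.
have cV x : pos_orthant x ->
    {for x, continuous (gradient (fine_value L (diag_mx a) N rho gamma p))}.
  by move=> x0; exact: (hVC1 x x0).2.
(* Some coordinate is needed in order to construct two distinct admissible controls. *)
pose i0 : 'I_n := Ordinal (ltnW hn).
apply: (optimal_representative hp hK.1 iC cV).
  by move=> t; exact: (gradient_N_gt0 hrho hgamma hp metzler hN hVfin dV hC hK K0 i0).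
exact: (optimal_feedback_ae hrho hgamma hp metzler hN hVfin dV hC hK K0 i0).
Qed.
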